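(* Let $L \ge 2$. Then the following hold. (a) For every $p \in (0,\infty]$, $\mathcal{F}^{(L)}_p$ is a vector space, and $\mathscr{C}^{(L)}_p$ is non-decreasing in $p$ (i.e. $\mathscr{C}^{(L)}_{p'}(f) \le \mathscr{C}^{(L)}_{p}(f)$ for every function $f$ on $\mathcal{X}$ whenever $p' \le p$). (b) If $p \in [2,\infty]$ and $\sigma$ is $J_\sigma$-Lipschitz with $\sigma(0)=0$, then for every $f \in \mathcal{F}^{(L)}_p$ we have $|f(x)| \le (J_\sigma)^{L-1}\, \mathscr{C}^{(L)}_p(f)\, \|x\|$ for all $x \in \mathcal{X}$, and $f$ is Lipschitz on $\mathcal{X}$ with constant $(J_\sigma)^{L-1}\, \mathscr{C}^{(L)}_p(f)$. Hence $\mathcal{F}^{(L)}_p \subseteq \mathcal{C}$. (c) If $\sigma$ is $1$-homogeneous, then $\mathscr{C}^{(L)}_p$ is the same for all $p \in [2,\infty]$. Moreover, for each such $p$, $\mathcal{F}^{(L)}_p$ is a quasi-Banach space with $\mathscr{C}^{(L)}_p$ as the quasi-norm.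
   Context: $\mathcal{X} \subset \mathbb{R}^d$ is compact; $\mathcal{C}$ is the space of continuous functions on $\mathcal{X}$ with the sup-norm and its Borel sigma-algebra; $\sigma:\mathbb{R}\to\mathbb{R}$ is a fixed activation function; $\|\cdot\|$ is the Euclidean norm. $\sigma$ is $1$-homogeneous if $\sigma(au)=a\sigma(u)$ for all $u\in\mathbb{R}$, $a\ge 0$. $\mathcal{P}(U)$ is the set of probability measures on a measurable space $U$. RKHS = reproducing kernel Hilbert space (of functions on $\mathcal{X}$). For a probability measure $\mu$ on functions on $\mathcal{X}$ (e.g. $\mu\in\mathcal{P}(\mathcal{C})$), put $\kappa_\mu(x,x') = \int \sigma(h(x))\sigma(h(x'))\,\mu(dh)$ (assumed finite), and let $\mathcal{H}_\mu$ be the RKHS on $\mathcal{X}$ with kernel $\kappa_\mu$. For an RKHS $\mathcal{H}$, $\mathcal{P}(\mathcal{H})$ denotes probability measures on functions on $\mathcal{X}$ concentrated on $\mathcal{H}$. For $\mu\in\mathcal{P}(\mathcal{H})$, $\|\mu\|_{\mathcal{H},p} = (\int \|h\|_{\mathcal{H}}^p\,\mu(dh))^{1/p}$ for $0<p<\infty$, and $\|\mu\|_{\mathcal{H},\infty}$ is the $\mu$-essential supremum of $\|\cdot\|_{\mathcal{H}}$. $\mathcal{H}^{(1)} = \{x\mapsto z^\top x : z\in\mathbb{R}^d\}$ with the inner product inherited from $\mathbb{R}^d$ (it is the RKHS of the kernel $x^\top x'$). For RKHSs $\mathcal{H},\mathcal{H}'$ on $\mathcal{X}$: $\mathscr{D}_p(\mathcal{H},\mathcal{H}')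 = \inf\{\|\mu\|_{\mathcal{H},p} : \mu\in\mathcal{P}(\mathcal{H}),\ \mathcal{H}_\mu=\mathcal{H}'\}$ (i.e. $\kappa_\mu$ is the kernel of $\mathcal{H}'$). For an RKHS $\mathcal{H}$ and $L\ge2$: $\mathscr{D}^{(L)}_p(\mathcal{H}) = \inf_{\mathcal{H}^{(2)},\dots,\mathcal{H}^{(L-1)}} \prod_{l=1}^{L-1}\mathscr{D}_p(\mathcal{H}^{(l)},\mathcal{H}^{(l+1)})$ with $\mathcal{H}^{(L)}=\mathcal{H}$, the infimum being over RKHSs $\mathcal{H}^{(2)},\dots,\mathcal{H}^{(L-1)}$ on $\mathcal{X}$. For a function $f$ on $\mathcal{X}$: $\mathscr{C}^{(L)}_p(f) = \inf_{\mathcal{H}} \big(\|f\|_{\mathcal{H}}\cdot \mathscr{D}^{(L)}_p(\mathcal{H})\big)$ over RKHSs $\mathcal{H}$ on $\mathcal{X}$. Conventions: an infimum over the empty set is $+\infty$, and in products only choices with all factors finite are considered (in particular $f\in\mathcal{H}$). Finally $\mathcal{F}^{(L)}_p = \{f : \mathscr{C}^{(L)}_p(f)<\infty\} = \bigcup_{\mathscr{D}^{(L)}_p(\mathcal{H})<\infty}\mathcal{H}$. A quasi-norm on a vector space $U$ is a functional $\|\cdot\|_U:U\to[0,\infty)$ that is positive-definite ($\|f\|_U>0$ if $f\ne0$), absolutely homogeneous, and satisfies $\|f+g\|_U\le K(\|f\|_U+\|g\|_U)$ for some constant $K\ge1$. A quasi-Banach space is a vector space with a quasi-norm that is complete in the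 induced topology.
   Formalization: In (a), the claim that the space is a vector space is stated for Borel-measurable σ; for a non-measurable σ the kernel integral may be undefined for every measure, so that the space is empty. *)

(* Defs.v *)
From HB Require Import structures.
From mathcomp Require Import all_boot all_order all_algebra.
From mathcomp Require Import all_classical all_reals all_analysis.

Set Implicit Arguments.
Unset Strict Implicit.
Unset Printing Implicit Defensive.

Import Order.TTheory GRing.Theory Num.Theory.
Import numFieldNormedType.Exports.

Local Open Scope classical_set_scope.
Local Open Scope ring_scope.

Section normed_subspaces.
Context {R : realType} {V : lmodType R}.
Implicit Types (S : set V) (N : V -> \bar R).

Definition linear_subspace S : Prop :=
  S 0 /\ forall (a : R) (f g : V), S f -> S g -> S (a *: f + g).

(* The topologies concerned are metrizable, so that Cauchy sequences suffice. *)
Definition complete_for S N : Prop :=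
  forall u : nat -> V, (forall n, S (u n)) ->
    (forall e : R, 0 < e -> exists n0 : nat, forall m n : nat,
      (n0 <= m)%N -> (n0 <= n)%N -> (N (u m - u n)%R < e%:E)%E) ->
    exists2 f : V, S f & forall e : R, 0 < e -> exists n0 : nat, forall n : nat,
      (n0 <= n)%N -> (N (u n - f)%R < e%:E)%E.

Definition quasi_norm_on S N : Prop :=
  [/\ forall f, S f -> (0 <= N f < +oo)%E,
      forall f, S f -> f <> 0 -> (0 < N f)%E,
      forall (a : R) f, S f -> N (a *: f) = (`|a|%R%:E * N f)%E
    & exists2 K : R, 1 <= K & forall f g, S f -> S g ->
        (N (f + g)%R <= K%:E * (N f + N g))%E].

Definition quasi_banach S N : Prop :=
  [/\ linear_subspace S, quasi_norm_on S N & complete_for S N].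

End normed_subspaces.

(* A Hilbert space of functions on T with a reproducing kernel. Only the
   values of the inner product on the carrier are meaningful. *)
Record rkhs (R : realType) (T : Type) := RKHS {
  carrier : set (T -> R);
  inner : (T -> R) -> (T -> R) -> R;
  kern : T -> T -> R;
  carrier_subspace : linear_subspace carrier;
  inner_sym : forall f g, carrier f -> carrier g -> inner f g = inner g f;
  inner_linear : forall (a : R) f g h, carrier f -> carrier g -> carrier h ->
    inner (a *: f + g) h = a * inner f h + inner g h;
  inner_ge0 : forall f, carrier f -> 0 <= inner f f;
  inner_definite : forall f, carrier f -> inner f f = 0 -> f = 0;
  carrier_complete :
    complete_for carrier (fun f => (Num.sqrt (inner f f))%:E);
  kern_carrier : forall x, carrier (kern x);
  kern_reproducing : forall f x, carrier f -> inner f (kern x) = f x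
}.

Section ladder.
Context {R : realType}.

Section rkhs_measures.
Context {T : Type}.
Implicit Types H : rkhs R T.

Definition rkhs_norm H (f : T -> R) : \bar R :=
  if `[< carrier H f >] then (Num.sqrt (inner H f f))%:E else +oo%E.

(* The sets of functions on T whose trace on H is open in H. The sigma-algebra
   they generate consists of the sets whose trace on H is Borel in H. If H is
   separable, that trace is generated by the evaluations; in particular, if H
   is made of continuous functions on a compact metric space, a probability
   measure concentrated on H for this sigma-algebra amounts to a Borel
   probability measure, on the space of continuous functions with the sup-norm,
   concentrated on H. *)
Definition rkhs_open H : set (set (T -> R)) :=
  [set A | forall f, carrier H f -> A f -> exists2 e : R, 0 < e &
    forall g, carrier H g -> (rkhs_norm H (g - f)%R < e%:E)%E -> A g].

Definition rkhs_probability H := probability (g_sigma_algebraType (rkhs_open H)) R.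

Definition concentrated H (mu : rkhs_probability H) : Prop :=
  mu (carrier H) = 1%E.

Definition has_kernel_of (sigma : R -> R) H (mu : rkhs_probability H) H' : Prop :=
  forall x y : T,
    mu.-integrable setT (fun h : T -> R => (sigma (h x) * sigma (h y))%R%:E) /\
    (kern H' x y)%:E = (\int[mu]_h (sigma (h x) * sigma (h y))%R%:E)%E.

Definition step_cost (sigma : R -> R) (p : \bar R) H H' : \bar R :=
  ereal_inf [set ('N[mu]_p[rkhs_norm H])%E | mu in
    [set mu : rkhs_probability H | concentrated mu /\ has_kernel_of sigma mu H']].

End rkhs_measures.

Definition dotv {d : nat} (z x : 'rV[R]_d) : R := \sum_(i < d) z 0 i * x 0 i.

Definition enorm {d : nat} (x : 'rV[R]_d) : R := Num.sqrt (dotv x x).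

Context {d : nat} {X : set 'rV[R]_d}.

(* The kernel of an RKHS determines the inner product on its carrier; here
   the norm of f is the least norm of a vector z representing f, the vector
   being unique when X spans the space. *)
Definition is_linear_rkhs (H : rkhs R X) : Prop :=
  carrier H = [set f | exists z, f = fun x : X => dotv z (\val x)] /\
  forall x y : X, kern H x y = dotv (\val x) (\val y).

(* Only the spaces with indices 1, ..., L of a chain are relevant. *)
Definition is_ladder (sigma : R -> R) (p : \bar R) (L : nat) (H : rkhs R X)
    (chain : nat -> rkhs R X) : Prop :=
  [/\ is_linear_rkhs (chain 1%N), chain L = H &
      forall l : nat, (1 <= l < L)%N ->
        (step_cost sigma p (chain l) (chain l.+1) < +oo)%E].

Definition ladder_cost (sigma : R -> R) (p : \bar R) (L : nat)
    (H : rkhs R X) : \bar R :=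
  ereal_inf
    [set (\big[*%E/1%E]_(1 <= l < L)
            step_cost sigma p (chain l) (chain l.+1))%E
     | chain in is_ladder sigma p L H].

Definition complexity (sigma : R -> R) (p : \bar R) (L : nat)
    (f : X -> R) : \bar R :=
  ereal_inf
    [set (rkhs_norm H f * ladder_cost sigma p L H)%E | H in
      [set H : rkhs R X |
        carrier H f /\ (ladder_cost sigma p L H < +oo)%E]].

Definition ladder_space (sigma : R -> R) (p : \bar R) (L : nat) :
    set (X -> R) :=
  [set f | (complexity sigma p L f < +oo)%E].

End ladder.

(* Main.v *)
(** The theory of an RKHS is read off its kernel k: a function f lies in the ball
    of radius s iff (sum a_i f(x_i))^2 <= s^2 sum a_i a_j k(x_i, x_j) for all finite
    combinations, and every positive semi-definite k is the kernel of a space,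
    the dual of the space of combinations. Chains of spaces are thus handled as
    chains of kernels linked by measures.

    (a) Two chains are merged by averaging their kernels and their measures at
    every level; Lp norms increase with p for probability measures.

    (b) If a measure mu on H satisfies |mu|_2 <= B, then the kernel k' of mu
    satisfies k'(x, x) <= (J B)^2 k(x, x), and likewise for
    k(x, x) - 2 k(x, y) + k(y, y); this is iterated along the chain.

    (c) For homogeneous sigma, giving h the weight |h|^2 and moving it to a
    sphere preserves the kernel of mu and turns an L2 bound into a sup bound.
    Rescaling the kernels makes all the costs of a chain at most 1. Countably many
    such chains k_{n,l} merge into one, with kernels
    sum_n 2^{-(n+1)(l-1)} k_{n,l}: mixing the measures with weights 2^{-(n+1)}
    after a dilation absorbs the factor lost at each level. Two chains give the
    quasi-triangle inequality, a fast Cauchy sequence gives completeness. *)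

Require Import Defs.
From HB Require Import structures.
From mathcomp Require Import all_boot all_order all_algebra.
From mathcomp Require Import all_classical all_reals all_analysis.
From mathcomp Require Import measurable_realfun ess_sup_inf.
From mathcomp Require Import ring lra.

Set Implicit Arguments.
Unset Strict Implicit.
Unset Printing Implicit Defensive.

Import Order.TTheory GRing.Theory Num.Theory.
Import numFieldNormedType.Exports.

Local Open Scope classical_set_scope.
Local Open Scope ring_scope.

(** * Inner products from the parallelogram law *)

(** The obstacle in (c) is to add infinitely many chains at a bounded cost. If the kernels at level
    [l] are summed with weights [half n ^+ l.-1], the space of the [n]-th chain embeds into that of
    the sum with norm at most [half n] to the power [-(l-1)/2]. Dilating its measure by the inverse
    factor makes the embedding contractive and, by homogeneity, multiplies the kernel produced by
    [half n ^+ l.-1]; mixing with weights [half n] then gives [half n ^+ l], precisely the weight of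
    level [l + 1]. Level 1 has weight 1, so that all chains start from the same linear space. The
    price is paid only once, as the norm of the embedding of the last spaces. For general [sigma] no
    dilation is available: (a) merges two chains, and pays a factor at every level. The
    sigma-algebra on functions depends on the space. Moving a measure is therefore a pushforward
    along a map measurable between two different structures, and the new measure is known only
    through its integrals of nonnegative functions; concentration, kernel and norm bound are all
    expressed by such integrals. *)

Section polarization.
Context {R : realType} {V : lmodType R}.
Variables (S : set V) (N : V -> R).
Hypothesis Ssub : linear_subspace S.
Hypothesis N_ge0 : forall f, S f -> 0 <= N f.
Hypothesis NZ : forall t f, S f -> N (t *: f) = t ^+ 2 * N f.
Hypothesis N_parallelogram : forall f g, S f -> S g ->
  N (f + g) + N (f - g) = 2 * (N f + N g).

(** [N] plays the role of a squared norm, so that this is the real polarization formula. *)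
Definition polar f g := (N (f + g) - N (f - g)) / 4.

Lemma subspaceD f g : S f -> S g -> S (f + g).
Proof. by move=> Sf Sg; have := Ssub.2 1 _ _ Sf Sg; rewrite scale1r. Qed.

Lemma subspaceZ (t : R) f : S f -> S (t *: f).
Proof. by move=> Sf; have := Ssub.2 t _ _ Sf Ssub.1; rewrite addr0. Qed.

Lemma subspaceN f : S f -> S (- f).
Proof. by rewrite -scaleN1r; exact: subspaceZ. Qed.

Let NN f : S f -> N (- f) = N f.
Proof. by move=> Sf; rewrite -scaleN1r NZ// sqrrN expr1n mul1r. Qed.

Lemma polar_sym f g : S f -> S g -> polar f g = polar g f.
Proof.
move=> Sf Sg; rewrite /polar (addrC g f) -(opprB f g) (NN (f := f - g))//.
exact/subspaceD/subspaceN.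
Qed.

(** The parallelogram law is used for the pairs [f + h], [g] and [g + h], [f], and for the same
    pairs with [- h]; in the difference the mixed terms cancel because [N] is even. *)
Lemma polarDl f g h : S f -> S g -> S h ->
  polar (f + g) h = polar f h + polar g h.
Proof.
move=> Sf Sg Sh.
have SD := subspaceD; have SN := subspaceN.
have P e := N_parallelogram (SD _ _ Sf e) Sg.
have Q e := N_parallelogram (SD _ _ Sg e) Sf.
have [P1 P2 Q1 Q2] := And4 (P h Sh) (P (- h) (SN _ Sh)) (Q h Sh) (Q (- h) (SN _ Sh)).
have e1 : g + h + f = f + h + g by rewrite addrAC (addrC g) addrAC.
have e2 : g - h + f = f - h + g by rewrite addrAC (addrC g) addrAC.
have e3 : N (g + h - f) = N (f - h - g).
  by rewrite -(NN (f := g + h - f)) ?opprD ?opprK; [|exact/SD/SN/Sf/SD];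
     congr N; rewrite addrC addrA addrAC.
have e4 : N (g - h - f) = N (f + h - g).
  by rewrite -(NN (f := g - h - f)) ?opprD ?opprK; [|exact/SD/SN/Sf/SD/SN];
     congr N; rewrite addrC addrA addrAC.
move: P1 P2 Q1 Q2; rewrite e1 e2 e3 e4 /polar (addrAC f g h) (addrAC f g (- h)).
by lra.
Qed.

Lemma polar_diag f : S f -> polar f f = N f.
Proof.
move=> Sf; rewrite /polar subrr -(scale0r f) -mulr2n -scaler_nat !NZ//.
by rewrite expr0n/= mul0r subr0 mulrAC -natrX divff ?mul1r ?pnatr_eq0.
Qed.

Let polar0 h : S h -> polar 0 h = 0.
Proof. by move=> Sh; rewrite /polar add0r sub0r NN// subrr mul0r. Qed.

Let polarZn n f h : S f -> S h -> polar (n%:R *: f) h = n%:R * polar f h.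
Proof.
move=> Sf Sh; elim: n => [|n IH]; first by rewrite scale0r polar0// mul0r.
rewrite -addn1 natrD scalerDl scale1r polarDl// ?IH ?mulrDl ?mul1r//.
exact: subspaceZ.
Qed.

Let polarN f h : S f -> S h -> polar (- f) h = - polar f h.
Proof.
move=> Sf Sh; apply/eqP; rewrite -subr_eq0 opprK -polarDl ?addNr ?polar0//.
exact: subspaceN.
Qed.

Let polarZz (z : int) f h : S f -> S h -> polar (z%:~R *: f) h = z%:~R * polar f h.
Proof.
move=> Sf Sh; case: (intP z) => [|n|n].
- by rewrite scale0r polar0// mul0r.
- by rewrite -pmulrn polarZn.
- rewrite mulrNz scaleNr polarN// ?mulNr -?pmulrn ?polarZn//.
  exact: subspaceZ.
Qed.

(* Additivity gives integer homogeneity; for real t, the defect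
   polar (t f) h - t * polar f h is additive in t, vanishes on the integers and
   is bounded on [0, 1[, hence zero. *)
Lemma polarZl t f h : S f -> S h -> polar (t *: f) h = t * polar f h.
Proof.
move=> Sf Sh.
pose psi t := polar (t *: f) h - t * polar f h.
have psiD s u : psi (s + u) = psi s + psi u.
  by rewrite /psi scalerDl polarDl ?mulrDl; [ring|exact: subspaceZ|exact: subspaceZ|].
have psiz (z : int) : psi z%:~R = 0 by rewrite /psi polarZz// subrr.
have psiMn n s : psi (n%:R * s) = n%:R * psi s.
  elim: n => [|n IH]; first by rewrite !mul0r; exact: (psiz 0).
  by rewrite -addn1 natrD !mulrDl !mul1r psiD IH.
pose C := (N f + N h + `|polar f h|).
have psi_bd s : 0 <= s < 1 -> `|psi s| <= C.
  move=> /andP[s0 s1]; have Sfs := subspaceZ s Sf.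
  have := N_parallelogram Sfs Sh; rewrite NZ//.
  have := N_ge0 (subspaceD Sfs Sh).
  have := N_ge0 (subspaceD Sfs (subspaceN Sh)).
  have : s ^+ 2 * N f <= N f by rewrite ler_piMl ?N_ge0// exprn_ile1// ltW.
  have : `|s * polar f h| <= `|polar f h|.
    by rewrite normrM ler_piMl// (ger0_norm s0) ltW.
  have := N_ge0 Sf; have := N_ge0 Sh.
  rewrite /C => ? ? ? ? ? ? E; apply: (le_trans (ler_normB _ _)).
  apply: lerD => //; rewrite /polar ler_norml; apply/andP; split; lra.
have C0 : 0 <= C by rewrite /C !addr_ge0 ?N_ge0.
apply/eqP; rewrite -subr_eq0 -/(psi t); apply/negPn/negP => psit.
have psit0 : 0 < `|psi t| by rewrite normr_gt0.
pose n := Num.truncn (C / `|psi t|).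
have : C < n.+1%:R * `|psi t|.
  by rewrite -ltr_pdivrMr// truncnS_gt.
rewrite -[X in X * _]normr_nat -normrM -psiMn ltNge => /negP; apply.
set u := _ * t; rewrite -(subrK (Num.floor u)%:~R u) psiD psiz addr0 psi_bd//.
by have := floor_itv u; rewrite intrD => /andP[? ?]; apply/andP; split; lra.
Qed.

End polarization.

(** * Kernels and their spaces *)

Lemma real_cauchy_lim (R : realType) (u : nat -> R) :
  (forall e, 0 < e -> exists n0, forall m n, (n0 <= m)%N -> (n0 <= n)%N ->
    `|u m - u n| < e) ->
  exists l, forall e, 0 < e ->
    exists n0, forall n, (n0 <= n)%N -> `|u n - l| < e.
Proof.
move=> uC; have /cvg_ex[l ul] : cvgn u.
  apply/cauchy_cvgP/cauchy_exP => e e0; have [n0 H] := uC e e0.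
  exists (u n0), n0 => // n /= n0n; apply: H => //.
exists l => e e0; move/cvgrPdist_lt : ul => /(_ e e0)[n0 _ H].
by exists n0 => n /H; rewrite distrC.
Qed.

Section combinations.
Context {R : realType} {T : Type}.
Implicit Types (a b : seq (R * T)) (f g : T -> R) (k : T -> T -> R).

(* A finite combination of point masses, acting on functions. *)
Definition combo a f : R := \sum_(i <- a) i.1 * f i.2.

Definition combo_scale (t : R) a := [seq (t * i.1, i.2) | i <- a].

Definition gram k a b : R := combo a (fun x => combo b (k x)).

Definition psd k : Prop :=
  (forall x y, k x y = k y x) /\ forall a, 0 <= gram k a a.

Lemma combo1 t x f : combo [:: (t, x)] f = t * f x.
Proof. by rewrite /combo big_seq1. Qed.

Lemma combo_cat a b f : combo (a ++ b) f = combo a f + combo b f.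
Proof. by rewrite /combo big_cat. Qed.

Lemma comboZl t a f : combo (combo_scale t a) f = t * combo a f.
Proof.
rewrite /combo big_map mulr_sumr; apply: eq_bigr => i _ /=.
by rewrite mulrA.
Qed.

Lemma comboD a f g : combo a (f + g) = combo a f + combo a g.
Proof. by rewrite /combo -big_split; apply: eq_bigr => i _ /=; rewrite mulrDr. Qed.

Lemma comboZr t a f : combo a (t *: f) = t * combo a f.
Proof. by rewrite /combo mulr_sumr; apply: eq_bigr => i _ /=; rewrite mulrCA. Qed.

Lemma comboB a f g : combo a (f - g) = combo a f - combo a g.
Proof. by rewrite -scaleN1r comboD comboZr mulN1r. Qed.

Lemma combo_exchange a b k :
  combo a (fun x => combo b (k x)) = combo b (fun y => combo a (k^~ y)).
Proof.
rewrite /combo; under eq_bigr do rewrite mulr_sumr.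
rewrite exchange_big; apply: eq_bigr => i _ /=; rewrite mulr_sumr.
by apply: eq_bigr => j _; rewrite mulrCA.
Qed.

Lemma gram_catl k a b c : gram k (a ++ b) c = gram k a c + gram k b c.
Proof. exact: combo_cat. Qed.

Lemma gramZl k t a b : gram k (combo_scale t a) b = t * gram k a b.
Proof. exact: comboZl. Qed.

Lemma gram_catr k a b c : gram k c (a ++ b) = gram k c a + gram k c b.
Proof.
by rewrite /gram -comboD; congr combo; apply/funext => x; rewrite combo_cat.
Qed.

Lemma gramZr k t a b : gram k b (combo_scale t a) = t * gram k b a.
Proof.
by rewrite /gram -comboZr; congr combo; apply/funext => x; rewrite comboZl.
Qed.

Lemma gramC k a b : (forall x y, k x y = k y x) -> gram k a b = gram k b a.
Proof.
move=> kC; rewrite /gram combo_exchange; congr combo; apply/funext => x.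
by congr combo; apply/funext.
Qed.

Lemma gram1 k t x : gram k [:: (t, x)] [:: (t, x)] = t ^+ 2 * k x x.
Proof. by rewrite /gram !combo1 mulrA -expr2. Qed.

(* Its supremum over [a] is the squared norm of [f] in the space of kernel [k]. *)
Definition dual_gap k f a := 2 * combo a f - gram k a a.

(** The choice [t = b / q] is optimal. If [q = 0], a linear function of [t] bounded above has slope
    0: otherwise the [t] chosen gives it the value [s + 1]. *)
Lemma quadratic_le (b q s : R) : (forall t, 2 * t * b - t ^+ 2 * q <= s) ->
  0 <= q -> b ^+ 2 <= s * q.
Proof.
move=> H; rewrite le_eqVlt => /predU1P[q0|q0].
  subst q; rewrite mulr0; have [->|b0] := eqVneq b 0; first by rewrite expr0n.
  have := H ((s + 1) / (2 * b)); rewrite mulr0 subr0.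
  rewrite [X in X <= _](_ : _ = s + 1); last by field.
  by lra.
have := H (b / q); rewrite [X in X <= _](_ : _ = b ^+ 2 / q).
  by rewrite ler_pdivrMr.
by field; rewrite gt_eqF.
Qed.

(** Arithmetic-geometric mean inequality: [4 b^2 <= 4 s q <= (s + q)^2]. *)
Lemma le_quadratic (b q s : R) : 0 <= q -> 0 <= s -> b ^+ 2 <= s * q ->
  2 * b - q <= s.
Proof.
move=> q0 s0 bqs; rewrite lerBlDr; apply: (le_trans (ler_norm _)).
rewrite -ler_sqr ?nnegrE ?addr_ge0//.
by have := sqr_ge0 (s - q); rewrite real_normK ?num_real//; lra.
Qed.

(** Replacing [a] by its multiples turns the inhomogeneous bound into a Cauchy-Schwarz inequality.
    The first form suits suprema, the second suits comparisons of kernels. *)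
Lemma dual_gap_leP k f s : psd k -> 0 <= s ->
  (forall a, dual_gap k f a <= s) <->
  (forall a, combo a f ^+ 2 <= s * gram k a a).
Proof.
move=> [_ kp] s0; split=> H a.
  apply: quadratic_le (kp a) => t.
  by have := H (combo_scale t a); rewrite /dual_gap comboZl gramZl gramZr; lra.
exact: le_quadratic.
Qed.

Lemma dual_gap_le_ge0 k f s : (forall a, dual_gap k f a <= s) -> 0 <= s.
Proof.
by move/(_ [::]); rewrite /dual_gap /gram /combo !big_nil mulr0 subrr.
Qed.

Definition moore_carrier k : set (T -> R) :=
  [set f | exists s, forall a, dual_gap k f a <= s].

Definition moore_normsq k f : R := sup (range (dual_gap k f)).

Lemma dual_gap_le k f a : moore_carrier k f -> dual_gap k f a <= moore_normsq k f.
Proof.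
move=> [s fs]; apply: sup_upper_bound; last by exists a.
by split; [exists (dual_gap k f a), a|exists s => _ [b _ <-]].
Qed.

Lemma moore_normsq_le k f s :
  (forall a, dual_gap k f a <= s) -> moore_normsq k f <= s.
Proof.
move=> fs; apply: ge_sup; first by exists (dual_gap k f [::]), [::].
by move=> _ [a _ <-].
Qed.

Lemma moore_normsq_ge0 k f : moore_carrier k f -> 0 <= moore_normsq k f.
Proof.
by move=> kf; apply: (@dual_gap_le_ge0 k f) => a; exact: dual_gap_le.
Qed.

Lemma combo_sqr_le k f a : psd k -> moore_carrier k f ->
  combo a f ^+ 2 <= moore_normsq k f * gram k a a.
Proof.
move=> kp kf; have [+ _] := dual_gap_leP f kp (moore_normsq_ge0 kf).
by apply => b; exact: dual_gap_le.
Qed.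

Lemma dual_gapZ k t f a :
  dual_gap k (t *: f) (combo_scale t a) = t ^+ 2 * dual_gap k f a.
Proof. by rewrite /dual_gap comboZl comboZr gramZl gramZr; ring. Qed.

Let combo_scaleK t a : t != 0 -> combo_scale t (combo_scale t^-1 a) = a.
Proof.
move=> t0; rewrite /combo_scale -map_comp -[RHS]map_id; apply: eq_map => i /=.
by rewrite mulVKf//; case: i.
Qed.

Lemma dual_gapZ_le k t f s : psd k -> (forall a, dual_gap k f a <= s) ->
  forall a, dual_gap k (t *: f) a <= t ^+ 2 * s.
Proof.
move=> [_ kp] fs a; have [->|t0] := eqVneq t 0.
  rewrite /dual_gap comboZr mul0r mulr0 sub0r expr0n/= mul0r oppr_le0.
  exact: kp.
by rewrite -(combo_scaleK a t0) dual_gapZ ler_wpM2l ?sqr_ge0.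
Qed.

Lemma moore_carrierZ k t f : psd k -> moore_carrier k f -> moore_carrier k (t *: f).
Proof. by move=> kp [s fs]; exists (t ^+ 2 * s); exact: dual_gapZ_le. Qed.

Lemma moore_normsqZ k t f : psd k -> moore_carrier k f ->
  moore_normsq k (t *: f) = t ^+ 2 * moore_normsq k f.
Proof.
move=> kp kf; have le u g : moore_carrier k g ->
    moore_normsq k (u *: g) <= u ^+ 2 * moore_normsq k g.
  move=> kg; apply: moore_normsq_le; apply: dual_gapZ_le => // a.
  exact: dual_gap_le.
apply/eqP; rewrite eq_le le//=; have [->|t0] := eqVneq t 0.
  by rewrite expr0n/= mul0r moore_normsq_ge0//; exact: moore_carrierZ.
have := le t^-1 _ (moore_carrierZ t kp kf).
rewrite scalerA mulVf// scale1r exprVn mulrC ler_pdivlMr 1?mulrC//.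
by rewrite exprn_even_gt0.
Qed.

(* The gap of f + g at a and of f - g at b are those of f and g at the
   half-sum and the half-difference of a and b. *)
Lemma dual_gap_parallelogram k f g a b : psd k ->
  dual_gap k (f + g) a + dual_gap k (f - g) b =
  2 * (dual_gap k f (combo_scale 2^-1 (a ++ b)) +
       dual_gap k g (combo_scale 2^-1 (a ++ combo_scale (-1) b))).
Proof.
move=> [kC _]; rewrite /dual_gap comboD comboB !(comboZl, combo_cat).
rewrite !(gramZl, gramZr, gram_catl, gram_catr) (gramC b a kC).
by field.
Qed.

Let normsqD_bound k f g : psd k -> moore_carrier k f -> moore_carrier k g ->
  forall a b, dual_gap k (f + g) a + dual_gap k (f - g) b <=
  2 * (moore_normsq k f + moore_normsq k g).
Proof.
move=> kp kf kg a b; rewrite dual_gap_parallelogram//.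
by rewrite ler_wpM2l// lerD// dual_gap_le.
Qed.

Lemma moore_carrierD k f g : psd k -> moore_carrier k f -> moore_carrier k g ->
  moore_carrier k (f + g).
Proof.
move=> kp kf kg; eexists => a; have := normsqD_bound kp kf kg a [::].
by rewrite {2}/dual_gap /gram /combo !big_nil mulr0 subrr addr0; exact.
Qed.

Lemma moore_subspace k : psd k -> linear_subspace (moore_carrier k).
Proof.
move=> kp; split=> [|t f g kf kg]; last first.
  exact/moore_carrierD/kg/moore_carrierZ.
exists 0 => a; rewrite /dual_gap -(scale0r (0 : T -> R)) comboZr mul0r mulr0.
by rewrite sub0r oppr_le0; exact: kp.2.
Qed.

(** The identity between gaps gives one inequality, by suprema over [a] and [b] separately. Applied
    to [f + g] and [f - g], it gives the other. *)
Lemma moore_parallelogram k f g :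
  psd k -> moore_carrier k f -> moore_carrier k g ->
  moore_normsq k (f + g) + moore_normsq k (f - g) =
  2 * (moore_normsq k f + moore_normsq k g).
Proof.
move=> kp.
have le u v : moore_carrier k u -> moore_carrier k v ->
    moore_normsq k (u + v) + moore_normsq k (u - v) <=
    2 * (moore_normsq k u + moore_normsq k v).
  move=> ku kv; rewrite -lerBrDr; apply: moore_normsq_le => a.
  rewrite lerBrDr -lerBrDl; apply: moore_normsq_le => b.
  by rewrite lerBrDl; exact: normsqD_bound.
move=> kf kg; apply/eqP; rewrite eq_le le//=.
have kB : moore_carrier k (f - g).
  by rewrite -scaleN1r; apply: moore_carrierD => //; exact: moore_carrierZ.
have := le _ _ (moore_carrierD kp kf kg) kB.
rewrite (_ : f + g + (f - g) = 2 *: f); last first.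
  by rewrite addrACA subrr addr0 -mulr2n scaler_nat.
rewrite (_ : f + g - (f - g) = 2 *: g); last first.
  by rewrite opprB addrC addrA subrK -mulr2n scaler_nat.
rewrite !moore_normsqZ//.
by lra.
Qed.

(** The difference of the two sides is the Gram form of [a] minus the point mass at [x]. *)
Lemma kern_gap k x a : psd k -> dual_gap k (k x) a <= k x x.
Proof.
move=> [kC kp]; have := kp (a ++ [:: (-1, x)]).
rewrite !(gram_catl, gram_catr) gram1 (gramC a [:: _] kC).
rewrite (_ : gram k [:: (-1, x)] a = - combo a (k x)).
  by rewrite /dual_gap; lra.
by rewrite /gram combo1 mulN1r.
Qed.

Lemma moore_kern k x : psd k -> moore_carrier k (k x).
Proof. by move=> kp; exists (k x x) => a; exact: kern_gap. Qed.

(** The reproducing property in terms of squared norms. Shifting the combination by a point mass at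
    [x] gives an upper bound; undoing the shift with [- t] gives the reverse one. *)
Lemma moore_normsqDkern k f t x : psd k -> moore_carrier k f ->
  moore_normsq k (f + t *: k x) = moore_normsq k f + 2 * t * f x + t ^+ 2 * k x x.
Proof.
move=> kp; have le u s : moore_carrier k u ->
    moore_normsq k (u + s *: k x) <=
    moore_normsq k u + 2 * s * u x + s ^+ 2 * k x x.
  move=> ku; apply: moore_normsq_le => a.
  have := dual_gap_le (a ++ [:: (- s, x)]) ku.
  rewrite /dual_gap !(gram_catl, gram_catr) gram1 (gramC a [:: _] kp.1).
  rewrite combo_cat combo1 comboD comboZr.
  rewrite (_ : combo a (k x) = gram k [:: (1, x)] a); last first.
    by rewrite /gram combo1 mul1r.
  rewrite (_ : gram k [:: (- s, x)] a = - s * gram k [:: (1, x)] a).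
    by lra.
  by rewrite /gram !combo1; ring.
move=> kf; apply/eqP; rewrite eq_le le//=.
have kfx : moore_carrier k (f + t *: k x).
  by apply: moore_carrierD => //; apply/moore_carrierZ => //; exact: moore_kern.
have := le _ (- t) kfx; rewrite scaleNr addrK (_ : (f + t *: k x) x = f x + t * k x x)//.
by rewrite sqrrN; lra.
Qed.

Lemma moore_eval k f x : psd k -> moore_carrier k f ->
  f x ^+ 2 <= moore_normsq k f * k x x.
Proof.
move=> kp kf; have := combo_sqr_le [:: (1, x)] kp kf.
by rewrite combo1 gram1 expr1n !mul1r.
Qed.

Lemma moore_definite k f : psd k -> moore_carrier k f ->
  moore_normsq k f = 0 -> f = 0.
Proof.
move=> kp kf f0; apply/funext => x; have := moore_eval x kp kf.
rewrite f0 mul0r => fx; apply/eqP; rewrite -sqrf_eq0.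
by rewrite eq_le fx sqr_ge0.
Qed.

(** The limit is pointwise, evaluations being bounded. For a fixed combination the gap is continuous
    under pointwise convergence, so the Cauchy bounds on [u n - u m] pass to [u n - f] uniformly in
    the combination. *)
Lemma moore_complete k : psd k ->
  complete_for (moore_carrier k) (fun f => (Num.sqrt (moore_normsq k f))%:E).
Proof.
move=> kp u ku uC.
have kB m n : moore_carrier k (u m - u n).
  by rewrite -scaleN1r; apply: moore_carrierD => //; exact: moore_carrierZ.
have {}uC e : 0 < e -> exists n0, forall m n, (n0 <= m)%N -> (n0 <= n)%N ->
    moore_normsq k (u m - u n) < e.
  move=> e0; have [|n0 H] := uC (Num.sqrt e); first by rewrite sqrtr_gt0.
  by exists n0 => m n /H/[apply]; rewrite lte_fin ltr_sqrt.
have ux x : exists l : R, forall e, 0 < e ->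
    exists n0, forall n, (n0 <= n)%N -> `|u n x - l| < e.
  apply: real_cauchy_lim => e e0.
  have kxx : 0 <= k x x by have := kp.2 [:: (1, x)]; rewrite gram1 expr1n mul1r.
  have [|n0 H] := uC (e ^+ 2 / (k x x + 1)).
    by rewrite divr_gt0 ?exprn_gt0 ?ltr_wpDl.
  exists n0 => m n /H/[apply]; rewrite ltr_pdivlMr ?ltr_wpDl// => mn.
  rewrite -ltr_sqr ?nnegrE ?(ltW e0)// real_normK ?num_real//.
  apply: le_lt_trans (moore_eval x kp (kB m n)) _; apply: le_lt_trans mn.
  by rewrite ler_wpM2l ?moore_normsq_ge0// ler_wpDr.
pose f x := sval (cid (ux x)).
have fP x e : 0 < e -> exists n0, forall n, (n0 <= n)%N -> `|u n x - f x| < e.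
  exact: (svalP (cid (ux x))).
have comboP a e : 0 < e ->
    exists n0, forall n, (n0 <= n)%N -> `|combo a (u n) - combo a f| < e.
  elim: a e => [|[t x] a IH] e e0.
    by exists 0%N => n _; rewrite /combo !big_nil subrr normr0.
  have [|n1 H1] := fP x (e / 2 / (`|t| + 1)).
    by rewrite !divr_gt0// ltr_wpDl.
  have [|n2 H2] := IH (e / 2); first by rewrite divr_gt0.
  exists (maxn n1 n2) => n; rewrite geq_max => /andP[/H1 + /H2].
  rewrite ltr_pdivlMr ?ltr_wpDl// => {}H1 {}H2.
  rewrite /combo !big_cons -!/(combo a _) opprD addrACA -mulrBr.
  apply: le_lt_trans (ler_normD _ _) _; rewrite normrM (splitr e).
  apply: ltrD => //; apply: le_lt_trans H1.
  by rewrite mulrC ler_wpM2l// lerDl.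
have fB e : 0 < e -> exists n0, forall n, (n0 <= n)%N ->
    forall a, dual_gap k (u n - f) a <= e.
  move=> e0; have [n0 H] := uC _ e0; exists n0 => n n0n a.
  apply/ler_addgt0Pr => d d0.
  have [|n1 H1] := comboP a (d / 2); first by rewrite divr_gt0.
  have := H n (maxn n0 n1) n0n (leq_maxl _ _).
  have := H1 (maxn n0 n1) (leq_maxr _ _); set m := maxn _ _.
  have := dual_gap_le a (kB n m); rewrite /dual_gap !comboB.
  by rewrite ltr_norml => ? /andP[? ?] ?; lra.
have fBk : exists n, moore_carrier k (u n - f).
  by have [n0 H] := fB 1 ltr01; exists n0, 1 => a; exact: H.
have kf : moore_carrier k f.
  have [n kn] := fBk; rewrite -[f](subKr (u n)) -scaleN1r.
  by apply: moore_carrierD => //; exact: moore_carrierZ.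
exists f => // e e0; have [|n0 H] := fB (e ^+ 2 / 2).
  by rewrite divr_gt0 ?exprn_gt0.
exists n0 => n /H {}H; rewrite lte_fin -(ger0_norm (ltW e0)) -sqrtr_sqr.
rewrite ltr_sqrt ?exprn_gt0//; apply: le_lt_trans (moore_normsq_le H) _.
by rewrite ltr_pdivrMr// ltr_pMr ?exprn_gt0// ltr1n.
Qed.

Theorem moore_aronszajn k : psd k -> exists H : rkhs R T, kern H = k.
Proof.
move=> kp; have kS := moore_subspace kp.
have N0 f := @moore_normsq_ge0 k f.
have NZ t f := @moore_normsqZ k t f kp.
have NP f g := @moore_parallelogram k f g kp.
pose B := polar (moore_normsq k).
have BD := polarDl kS NZ NP.
have BZ := polarZl kS N0 NZ NP.
have Bd f (kf : moore_carrier k f) : B f f = moore_normsq k f := polar_diag NZ kf.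
have Bsym f g := polar_sym kS NZ (f := f) (g := g).
have Blin (a : R) f g h : moore_carrier k f -> moore_carrier k g ->
    moore_carrier k h -> B (a *: f + g) h = a * B f h + B g h.
  move=> kf kg kh; rewrite -[B g h]/(polar _ g h) -BZ//.
  by rewrite -BD//; exact: moore_carrierZ.
have B0 f : moore_carrier k f -> 0 <= B f f.
  by move=> kf; rewrite Bd ?N0.
have Bdef f : moore_carrier k f -> B f f = 0 -> f = 0.
  by move=> kf; rewrite Bd//; exact: moore_definite.
have Bc : complete_for (moore_carrier k) (fun f => (Num.sqrt (B f f))%:E).
  move=> u ku uC; have kB m n : moore_carrier k (u m - u n).
    by rewrite -scaleN1r; apply: moore_carrierD => //; exact: moore_carrierZ.
  have [|f kf uf] := moore_complete kp ku.
    by move=> e /uC[n0 H]; exists n0 => m n nm nn; rewrite -Bd ?H.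
  exists f => // e /uf[n0 H]; exists n0 => n nn; rewrite Bd ?H//.
  by rewrite -scaleN1r; apply: moore_carrierD => //; exact: moore_carrierZ.
(* The squared norms of [f + k x] and [f - k x] differ by [4 * f x]. *)
have Brep f x : moore_carrier k f -> B f (k x) = f x.
  move=> kf; rewrite /B /polar -[f + k x]/(f + k x).
  have := moore_normsqDkern 1 x kp kf; have := moore_normsqDkern (-1) x kp kf.
  by rewrite scaleN1r scale1r => -> ->; field.
exists (RKHS kS Bsym Blin B0 Bdef Bc (fun x => moore_kern x kp) Brep).
by [].
Qed.

End combinations.

Lemma invS_lt (R : realType) (e : R) : 0 < e ->
  exists n0, forall n, (n0 <= n)%N -> n.+1%:R^-1 < e.
Proof.
move=> e0; exists (Num.truncn e^-1) => n nn.
rewrite invf_plt ?posrE//; apply: lt_le_trans (truncnS_gt _) _.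
by rewrite ler_nat ltnS.
Qed.

(** * Every reproducing kernel space coincides with the one built from its kernel *)

Section rkhs_dual.
Context {R : realType} {T : Type}.
Implicit Types (a b : seq (R * T)) (f g : T -> R) (H : rkhs R T).

Lemma carrierZ H t f : carrier H f -> carrier H (t *: f).
Proof. exact: (subspaceZ (carrier_subspace H)). Qed.

Lemma carrierD H f g : carrier H f -> carrier H g -> carrier H (f + g).
Proof. exact: (subspaceD (carrier_subspace H)). Qed.

Lemma carrierB H f g : carrier H f -> carrier H g -> carrier H (f - g).
Proof. by move=> Hf Hg; rewrite -scaleN1r; apply/carrierD/carrierZ. Qed.

Lemma kern_sym H x y : kern H x y = kern H y x.
Proof.
by rewrite -!(kern_reproducing _ (kern_carrier H _)) inner_sym//;
  exact: kern_carrier.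
Qed.

(** The Riesz representer in [H] of the functional [combo a]. *)
Definition kern_combo H a : T -> R := \sum_(i <- a) i.1 *: kern H i.2.

Lemma kern_comboE H a x : kern_combo H a x = combo a (kern H x).
Proof.
rewrite /kern_combo /combo fct_sumE; apply: eq_bigr => i _.
by rewrite kern_sym.
Qed.

Lemma kern_combo_carrier H a : carrier H (kern_combo H a).
Proof.
rewrite /kern_combo; elim: a => [|i a IH].
  by rewrite big_nil; have [] := carrier_subspace H.
rewrite big_cons; apply: carrierD => //; apply: carrierZ; exact: kern_carrier.
Qed.

Lemma inner_lin H (t : R) f g h : carrier H f -> carrier H g -> carrier H h ->
  inner H h (t *: f + g) = t * inner H h f + inner H h g.
Proof.
move=> Hf Hg Hh; rewrite inner_sym ?inner_linear//; last exact/carrierD/Hg/carrierZ.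
by rewrite (inner_sym Hf Hh) (inner_sym Hg Hh).
Qed.

Lemma inner_kern_combo H f a : carrier H f -> inner H f (kern_combo H a) = combo a f.
Proof.
move=> Hf; rewrite /kern_combo /combo; elim: a => [|i a IH].
  have H0 := (carrier_subspace H).1.
  rewrite !big_nil; have := inner_lin (-1) H0 H0 Hf.
  by rewrite scaler0 addr0 mulN1r addNr.
rewrite !big_cons inner_lin ?IH ?kern_reproducing//; first exact: kern_carrier.
exact: kern_combo_carrier.
Qed.

Lemma inner_kern_combo2 H a b :
  inner H (kern_combo H a) (kern_combo H b) = gram (kern H) a b.
Proof.
rewrite inner_kern_combo; last exact: kern_combo_carrier.
rewrite gramC; last exact: kern_sym.
by congr combo; apply/funext => x; rewrite kern_comboE.
Qed.

Lemma inner_subl H f g h : carrier H f -> carrier H g -> carrier H h ->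
  inner H (f - g) h = inner H f h - inner H g h.
Proof.
by move=> Hf Hg Hh; rewrite addrC -scaleN1r inner_linear// mulN1r addrC.
Qed.

Lemma inner_subr H f g h : carrier H f -> carrier H g -> carrier H h ->
  inner H h (f - g) = inner H h f - inner H h g.
Proof.
by move=> Hf Hg Hh; rewrite addrC -scaleN1r inner_lin// mulN1r addrC.
Qed.

Lemma kern_psd H : psd (kern H).
Proof.
split=> [|a]; first exact: kern_sym.
by rewrite -inner_kern_combo2 inner_ge0//; exact: kern_combo_carrier.
Qed.

(** Completion of the square. Hence the combinations that nearly maximize the gap are those whose
    representer is close to [f]. *)
Lemma inner_dual_gap H f a : carrier H f ->
  inner H (f - kern_combo H a) (f - kern_combo H a) =
  inner H f f - dual_gap (kern H) f a.
Proof.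
move=> Hf; have Ha := kern_combo_carrier H a.
rewrite inner_subl ?inner_subr//; try exact: carrierB.
rewrite (inner_sym Ha Hf) inner_kern_combo2 inner_kern_combo// /dual_gap.
by ring.
Qed.

Lemma dual_gap_le_inner H f a : carrier H f -> dual_gap (kern H) f a <= inner H f f.
Proof.
move=> Hf; rewrite -subr_ge0 -inner_dual_gap// inner_ge0//.
by apply: carrierB => //; exact: kern_combo_carrier.
Qed.

Lemma carrier_sub_moore H : carrier H `<=` moore_carrier (kern H).
Proof. by move=> f Hf; exists (inner H f f) => a; exact: dual_gap_le_inner. Qed.

Lemma moore_near H f (e : R) : moore_carrier (kern H) f -> 0 < e -> exists a,
  moore_normsq (kern H) f - e < dual_gap (kern H) f a /\
  moore_normsq (kern H) (f - kern_combo H a) <= e.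
Proof.
move=> kf e0.
have [|_ [a _ <-] ae] := @sup_adherent _ (range (dual_gap (kern H) f)) e e0.
  split; first by exists (dual_gap (kern H) f [::]), [::].
  by case: kf => s fs; exists s => _ [b _ <-].
have {}ae : moore_normsq (kern H) f - e < dual_gap (kern H) f a := ae.
exists a; split => //; apply: moore_normsq_le => b.
have := dual_gap_le (a ++ b) kf; have := ae.
rewrite /dual_gap comboB combo_cat.
rewrite !(gram_catl, gram_catr) (_ : combo b (kern_combo H a) = gram (kern H) a b).
  rewrite (gramC b a (@kern_sym H)).
  by lra.
by rewrite -inner_kern_combo2 inner_kern_combo//; exact: kern_combo_carrier.
Qed.

(** At the half-sum of [a] and [b] the gap exceeds the mean of its two values by a quarter of the
    Gram form of the difference. Near maximizers are thus close to each other. *)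
Lemma gram_sub_le k f a b : psd k -> moore_carrier k f ->
  gram k (a ++ combo_scale (-1) b) (a ++ combo_scale (-1) b) <=
  4 * moore_normsq k f - 2 * dual_gap k f a - 2 * dual_gap k f b.
Proof.
move=> kp kf; have := dual_gap_le (combo_scale 2^-1 (a ++ b)) kf.
rewrite /dual_gap !(comboZl, combo_cat, gramZl, gramZr, gram_catl, gram_catr).
by rewrite (gramC b a kp.1); lra.
Qed.

Lemma kern_comboB H a b :
  kern_combo H a - kern_combo H b = kern_combo H (a ++ combo_scale (-1) b).
Proof.
apply/funext => x; rewrite [LHS]/(kern_combo H a x - kern_combo H b x).
by rewrite !kern_comboE combo_cat comboZl mulN1r.
Qed.

Lemma moore_normsqD_le k f g : psd k -> moore_carrier k f -> moore_carrier k g ->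
  moore_normsq k (f + g) <= 2 * (moore_normsq k f + moore_normsq k g).
Proof.
move=> kp kf kg; rewrite -moore_parallelogram// lerDl moore_normsq_ge0//.
by rewrite -scaleN1r; apply: moore_carrierD => //; exact: moore_carrierZ.
Qed.

(* By the parallelogram law, the combinations nearly maximizing the dual gap of
   f form a Cauchy sequence; its limit in H is f. *)
Lemma moore_sub_carrier H f : moore_carrier (kern H) f ->
  carrier H f /\ inner H f f = moore_normsq (kern H) f.
Proof.
move=> kf; have kp := kern_psd H.
have mB := subspaceD (moore_subspace kp).
have mN := subspaceN (moore_subspace kp).
have /choice[a aP] : forall n : nat, exists a,
    moore_normsq (kern H) f - n.+1%:R^-1 < dual_gap (kern H) f a /\
    moore_normsq (kern H) (f - kern_combo H a) <= n.+1%:R^-1.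
  by move=> n; apply: moore_near => //; rewrite invr_gt0.
have sub_le n m : inner H (kern_combo H (a m) - kern_combo H (a n))
    (kern_combo H (a m) - kern_combo H (a n)) <= 2 * m.+1%:R^-1 + 2 * n.+1%:R^-1.
  rewrite kern_comboB inner_kern_combo2.
  have := gram_sub_le (a m) (a n) kp kf; have [+ _] := aP m; have [+ _] := aP n.
  by move: (m.+1%:R^-1) (n.+1%:R^-1) => ? ?; lra.
have ak n : carrier H (kern_combo H (a n)) by exact: kern_combo_carrier.
have [|g Hg gP] := carrier_complete ak.
  move=> e e0; have [|n0 n0P] := @invS_lt _ (e ^+ 2 / 4).
    by rewrite divr_gt0 ?exprn_gt0.
  exists n0 => m n /n0P m0 /n0P n0'; rewrite lte_fin -(ger0_norm (ltW e0)).
  rewrite -sqrtr_sqr ltr_sqrt ?exprn_gt0//; apply: le_lt_trans (sub_le _ _) _.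
  by move: (m.+1%:R^-1) (n.+1%:R^-1) m0 n0' => ? ?; lra.
have {}gP e : 0 < e -> exists n0, forall n, (n0 <= n)%N ->
    inner H (kern_combo H (a n) - g) (kern_combo H (a n) - g) < e.
  move=> e0; have [|n0 n0P] := gP (Num.sqrt e); first by rewrite sqrtr_gt0.
  by exists n0 => n /n0P; rewrite lte_fin ltr_sqrt.
have near e : 0 < e -> exists n, n.+1%:R^-1 < e /\
    inner H (kern_combo H (a n) - g) (kern_combo H (a n) - g) < e.
  move=> e0; have [n1 P1] := invS_lt e0; have [n2 P2] := gP e e0.
  by exists (maxn n1 n2); split; [exact/P1/leq_maxl|exact/P2/leq_maxr].
have kg := carrier_sub_moore Hg.
have fg : f = g.
  apply/eqP; rewrite -subr_eq0; apply/eqP; apply: (moore_definite kp).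
    exact/mB/mN.
  apply/eqP; rewrite eq_le moore_normsq_ge0 ?andbT; last exact/mB/mN.
  apply/ler_addgt0Pr => e e0; rewrite add0r.
  have [|n [n1 n2]] := near (e / 4); first by rewrite divr_gt0.
  rewrite -(subrKA (kern_combo H (a n))).
  have Hag : carrier H (kern_combo H (a n) - g) by exact: carrierB.
  apply: le_trans (moore_normsqD_le kp _ _) _.
  - by apply/mB => //; apply/mN/carrier_sub_moore.
  - exact: carrier_sub_moore.
  have : moore_normsq (kern H) (kern_combo H (a n) - g) <= e / 4.
    apply: moore_normsq_le => b; apply: le_trans (dual_gap_le_inner _ Hag) _.
    exact: ltW.
  by have [_] := aP n; move: (n.+1%:R^-1) n1 => ?; lra.
subst g; split => //; apply/eqP; rewrite eq_le; apply/andP; split; last first.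
  by apply: moore_normsq_le => b; exact: dual_gap_le_inner.
apply/ler_addgt0Pr => e e0; have [n [_ n2]] := near _ e0.
have := inner_dual_gap (a n) Hg; have := dual_gap_le (a n) kf.
rewrite (_ : inner H (f - _) (f - _) =
  inner H (kern_combo H (a n) - f) (kern_combo H (a n) - f)); first by lra.
rewrite !(inner_subl, inner_subr)//; try exact: carrierB.
by ring.
Qed.

Lemma carrierE H : carrier H = moore_carrier (kern H).
Proof.
apply/seteqP; split; first exact: carrier_sub_moore.
by move=> f /moore_sub_carrier[].
Qed.

Lemma inner_moore H f : carrier H f -> inner H f f = moore_normsq (kern H) f.
Proof. by move=> /carrier_sub_moore/moore_sub_carrier[]. Qed.

Lemma rkhs_ballP H f s : 0 <= s ->
  carrier H f /\ inner H f f <= s <->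
  forall a, combo a f ^+ 2 <= s * gram (kern H) a a.
Proof.
move=> s0; rewrite -dual_gap_leP//; last exact: kern_psd.
split=> [[Hf fs] a|fs]; first exact: le_trans (dual_gap_le_inner _ Hf) _.
have Hf : carrier H f by rewrite carrierE; exists s.
by split => //; rewrite inner_moore//; exact: moore_normsq_le.
Qed.

Definition rnorm H f : R := Num.sqrt (inner H f f).

Lemma rkhs_normE H f : carrier H f -> rkhs_norm H f = (rnorm H f)%:E.
Proof. by move=> Hf; rewrite /rkhs_norm asboolT. Qed.

Lemma rnorm_ge0 H f : 0 <= rnorm H f.
Proof. exact: sqrtr_ge0. Qed.

Lemma sqr_rnorm H f : carrier H f -> rnorm H f ^+ 2 = inner H f f.
Proof. by move=> Hf; rewrite sqr_sqrtr// inner_ge0. Qed.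

Lemma combo_rnorm H f a : carrier H f ->
  combo a f ^+ 2 <= rnorm H f ^+ 2 * gram (kern H) a a.
Proof.
move=> Hf; have [+ _] := @rkhs_ballP H f _ (sqr_ge0 (rnorm H f)).
by apply; rewrite sqr_rnorm.
Qed.

Lemma rnorm_leP H f s : 0 <= s ->
  carrier H f /\ rnorm H f <= s <->
  forall a, combo a f ^+ 2 <= s ^+ 2 * gram (kern H) a a.
Proof.
move=> s0; rewrite -rkhs_ballP ?sqr_ge0//.
split=> -[Hf fs]; split => //; first by rewrite -sqr_rnorm// ler_sqr ?nnegrE ?rnorm_ge0.
by rewrite -(ger0_norm s0) -sqrtr_sqr ler_sqrt ?sqr_ge0.
Qed.

(** Aronszajn's comparison: domination of kernels, in the order of positive semi-definite forms, is
    a norm bound for an embedding. All embeddings between spaces of different chains come from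
    here. *)
Lemma rnormZ_le H0 H (s M : R) : 0 <= M ->
  (forall a, s ^+ 2 * gram (kern H0) a a <= M ^+ 2 * gram (kern H) a a) ->
  forall f, carrier H0 f ->
    carrier H (s *: f) /\ rnorm H (s *: f) <= M * rnorm H0 f.
Proof.
move=> M0 kk f Hf; apply/rnorm_leP; first by rewrite mulr_ge0 ?rnorm_ge0.
move=> a; rewrite comboZr !exprMn.
apply: (@le_trans _ _ (s ^+ 2 * (rnorm H0 f ^+ 2 * gram (kern H0) a a))).
  by rewrite ler_wpM2l ?sqr_ge0// combo_rnorm.
by rewrite mulrCA [leRHS]mulrAC [leRHS]mulrC ler_wpM2l ?sqr_ge0.
Qed.

Lemma rnormZ H t f : carrier H f -> rnorm H (t *: f) = `|t| * rnorm H f.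
Proof.
move=> Hf; rewrite /rnorm !inner_moore//; last exact: carrierZ.
rewrite moore_normsqZ; [|exact: kern_psd|exact: carrier_sub_moore].
by rewrite sqrtrM ?sqr_ge0// sqrtr_sqr.
Qed.

Lemma rnorm_eval H f x : carrier H f ->
  `|f x| <= rnorm H f * Num.sqrt (kern H x x).
Proof.
move=> Hf; have := combo_rnorm [:: (1, x)] Hf.
rewrite combo1 gram1 expr1n !mul1r => fx.
rewrite -sqrtr_sqr -[rnorm H f]ger0_norm ?rnorm_ge0// -sqrtr_sqr.
by rewrite -sqrtrM ?sqr_ge0// ler_sqrt// (le_trans _ fx)// sqr_ge0.
Qed.

Lemma rnorm_eval2 H f x y : carrier H f ->
  `|f x - f y| <=
  rnorm H f * Num.sqrt (kern H x x - 2 * kern H x y + kern H y y).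
Proof.
move=> Hf; have := combo_rnorm ([:: (1, x)] ++ [:: (-1, y)]) Hf.
rewrite !(gram_catl, gram_catr) !gram1 combo_cat !combo1 /gram !combo1.
rewrite (kern_sym H y x).
rewrite [X in _ <= _ * X](_ : _ = kern H x x - 2 * kern H x y + kern H y y); last ring.
rewrite mul1r mulN1r => fx.
rewrite -sqrtr_sqr -[rnorm H f]ger0_norm ?rnorm_ge0// -sqrtr_sqr.
by rewrite -sqrtrM ?sqr_ge0// ler_sqrt// (le_trans _ fx)// sqr_ge0.
Qed.

Lemma rnormD_le H f g : carrier H f -> carrier H g ->
  rnorm H (f + g) <= rnorm H f + rnorm H g.
Proof.
move=> Hf Hg; apply: ((rnorm_leP _ _ _).2 _).2; first by rewrite addr_ge0 ?rnorm_ge0.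
move=> a; have ga := (kern_psd H).2 a.
have lin h : carrier H h -> `|combo a h| <= rnorm H h * Num.sqrt (gram (kern H) a a).
  move=> /(combo_rnorm a) le.
  rewrite -sqrtr_sqr -[rnorm H h]ger0_norm ?rnorm_ge0// -sqrtr_sqr.
  by rewrite -sqrtrM ?sqr_ge0// ler_sqrt// (le_trans _ le)// sqr_ge0.
rewrite -[gram _ a a]sqr_sqrtr// -exprMn -[_ ^+ 2]real_normK ?num_real//.
rewrite ler_sqr ?nnegrE ?mulr_ge0 ?addr_ge0 ?rnorm_ge0 ?sqrtr_ge0//.
rewrite comboD mulrDl; apply: (le_trans (ler_normD _ _)).
by apply: lerD; exact: lin.
Qed.

End rkhs_dual.

(** * The linear space *)

Section linear_space.
Context {R : realType} {d : nat} {X : set 'rV[R]_d}.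
Implicit Types (z w x : 'rV[R]_d).

Lemma dotvC z w : dotv z w = dotv w z.
Proof. by apply: eq_bigr => i _; rewrite mulrC. Qed.

Lemma dotvDl (t : R) z w x : dotv (t *: z + w) x = t * dotv z x + dotv w x.
Proof.
rewrite /dotv mulr_sumr -big_split; apply: eq_bigr => i _ /=.
by rewrite !mxE mulrDl mulrA.
Qed.

Lemma dotv0 x : dotv 0 x = 0.
Proof. by rewrite /dotv big1// => i _; rewrite mxE mul0r. Qed.

Lemma dotvB z w : dotv (z - w) (z - w) = dotv z z - 2 * dotv z w + dotv w w.
Proof.
rewrite /dotv mulr_sumr -sumrB -big_split; apply: eq_bigr => i _ /=.
by rewrite !mxE; ring.
Qed.

Lemma dotv_ge0 z : 0 <= dotv z z.
Proof. by apply: sumr_ge0 => i _; rewrite -expr2 sqr_ge0. Qed.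

Lemma coord_sqr_le z i : z 0 i ^+ 2 <= dotv z z.
Proof.
rewrite /dotv (bigD1 i)//= expr2 lerDl sumr_ge0// => j _.
by rewrite -expr2 sqr_ge0.
Qed.

Definition linear_kern (x y : X) : R := dotv (\val x) (\val y).

Let vec (a : seq (R * X)) : 'rV[R]_d := \sum_(i <- a) i.1 *: \val i.2.

Let combo_dotv a z : combo a (fun x : X => dotv z (\val x)) = dotv z (vec a).
Proof.
rewrite /combo /vec; elim: a => [|i a IH].
  by rewrite !big_nil dotvC dotv0.
by rewrite !big_cons IH [RHS]dotvC dotvDl !(dotvC _ z).
Qed.

Let gram_linear a b : gram linear_kern a b = dotv (vec a) (vec b).
Proof.
rewrite /gram dotvC -combo_dotv; congr combo; apply/funext => x.
by rewrite dotvC -combo_dotv.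
Qed.

Lemma linear_kern_psd : psd linear_kern.
Proof.
by split=> [x y|a]; [exact: dotvC|rewrite gram_linear dotv_ge0].
Qed.

(** A linear form lies in the space by Cauchy-Schwarz in ['rV[R]_d]. Conversely, combinations nearly
    maximizing the gap of [f] have Cauchy vectors [vec (a n)]; their coordinatewise limit [z]
    represents [f]. *)
Lemma linear_kernP (H : rkhs R X) : kern H = linear_kern -> is_linear_rkhs H.
Proof.
move=> kH; split; last by rewrite kH.
apply/seteqP; split => [f Hf|_ [z ->]]; last first.
  apply: ((rkhs_ballP _ _ (dotv_ge0 z)).2 _).1 => a.
  rewrite kH gram_linear combo_dotv; apply: quadratic_le (dotv_ge0 _) => t.
  have := dotv_ge0 (z - t *: vec a); rewrite dotvB.
  rewrite -[t *: vec a]addr0 !(dotvDl, dotvC z) !(dotvC (vec a) (_ + _)) !dotvDl !dotv0.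
  by lra.
have kf : moore_carrier (kern H) f by rewrite -carrierE.
have /choice[a aP] : forall n : nat, exists a,
    moore_normsq (kern H) f - n.+1%:R^-1 < dual_gap (kern H) f a /\
    moore_normsq (kern H) (f - kern_combo H a) <= n.+1%:R^-1.
  by move=> n; apply: moore_near => //; rewrite invr_gt0.
have vecB m n : dotv (vec (a m) - vec (a n)) (vec (a m) - vec (a n)) <=
    2 * m.+1%:R^-1 + 2 * n.+1%:R^-1.
  have := gram_sub_le (a m) (a n) (kern_psd H) kf.
  have -> : vec (a m) - vec (a n) = vec (a m ++ combo_scale (-1) (a n)).
    rewrite /vec big_cat big_map/= -sumrN; congr (_ + _).
    by apply: eq_bigr => i _; rewrite mulN1r scaleNr.
  rewrite -gram_linear -kH; have [+ _] := aP m; have [+ _] := aP n.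
  by move: (m.+1%:R^-1) (n.+1%:R^-1) => ? ?; lra.
have zP i : exists l : R, forall e, 0 < e ->
    exists n0, forall n, (n0 <= n)%N -> `|vec (a n) 0 i - l| < e.
  apply: real_cauchy_lim => e e0; have [|n0 n0P] := @invS_lt _ (e ^+ 2 / 4).
    by rewrite divr_gt0 ?exprn_gt0.
  exists n0 => m n /n0P m0 /n0P n0'.
  rewrite -ltr_sqr ?nnegrE ?(ltW e0)// real_normK ?num_real//.
  have := coord_sqr_le (vec (a m) - vec (a n)) i; rewrite !mxE.
  move=> /le_lt_trans; apply; apply: le_lt_trans (vecB _ _) _.
  by move: (m.+1%:R^-1) (n.+1%:R^-1) m0 n0' => ? ?; lra.
have /choice[z {}zP] := zP.
exists (\row_i z i); apply/funext => x.
apply/eqP; rewrite -subr_eq0 -normr_le0; apply/ler_addgt0Pr => e e0; rewrite add0r.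
(* An error [e / c] is made in norm and in each coordinate; it is multiplied by the first and the
   second term of [c] respectively, and the 1 keeps [c] positive. *)
pose c := Num.sqrt (linear_kern x x) + \sum_(i < d) `|\val x 0 i| + 1.
have c0 : 0 < c by rewrite ltr_wpDl// addr_ge0 ?sqrtr_ge0// sumr_ge0.
have ec0 : 0 < e / c by rewrite divr_gt0.
have [n [n1 n2]] : exists n, n.+1%:R^-1 < (e / c) ^+ 2 /\
    forall i, `|vec (a n) 0 i - z i| < e / c.
  have [|n1 n1P] := @invS_lt _ ((e / c) ^+ 2); first by rewrite exprn_gt0.
  have /choice[m mP] : forall i, exists n0, forall n, (n0 <= n)%N ->
    `|vec (a n) 0 i - z i| < e / c by move=> i; exact: zP.
  exists (maxn n1 (\max_i m i)); split; first exact/n1P/leq_maxl.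
  move=> i; apply: mP; apply: leq_trans (leq_maxr _ _).
  exact: (leq_bigmax i).
rewrite -(subrKA (dotv (vec (a n)) (\val x))).
have -> : e = e / c * Num.sqrt (linear_kern x x) +
    (e / c + e / c * \sum_(i < d) `|\val x 0 i|).
  by rewrite -{1}[e](divfK (lt0r_neq0 c0)) {2}/c; ring.
apply: (le_trans (ler_normD _ _)); apply: lerD.
  have Ha : carrier H (f - kern_combo H (a n)).
    by apply: carrierB => //; exact: kern_combo_carrier.
  have := rnorm_eval x Ha; rewrite kH.
  have -> : (f - kern_combo H (a n)) x = f x - dotv (vec (a n)) (\val x).
    by rewrite dotvC -combo_dotv -[LHS]/(f x - kern_combo H (a n) x) kern_comboE kH.
  move=> /le_trans; apply; rewrite ler_wpM2r ?sqrtr_ge0//.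
  rewrite -(ger0_norm (ltW ec0)) -sqrtr_sqr ler_sqrt ?sqr_ge0//.
  by rewrite inner_moore//; have [_] := aP n; move/le_trans; apply; exact: ltW.
apply: (@le_trans _ _ (e / c * \sum_(i < d) `|\val x 0 i|)); last first.
  by rewrite lerDr ltW.
rewrite /dotv -sumrB mulr_sumr; apply: le_trans (ler_norm_sum _ _ _) _.
apply: ler_sum => i _; rewrite mxE -mulrBl normrM.
by rewrite ler_wpM2r// ltW.
Qed.

Lemma is_linear_rkhs_kern (H : rkhs R X) : is_linear_rkhs H <-> kern H = linear_kern.
Proof.
split=> [[_ kH]|]; last exact: linear_kernP.
by apply/funext => x; apply/funext => y; exact: kH.
Qed.

End linear_space.

(** * Measures on function spaces *)

Section weighted_pushforward.
Local Open Scope ereal_scope.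
Context d1 d2 (X : measurableType d1) (Y : measurableType d2) (R : realType).
Variables (mu : {measure set X -> \bar R}) (g : X -> R) (phi : X -> Y).
Hypotheses (mg : measurable_fun [set: X] g) (g0 : forall x, (0 <= g x)%R).
Hypothesis mphi : measurable_fun [set: X] phi.

(** The image under [phi] of the measure of density [g]. It serves both to reweight a measure and,
    with [g] constant, to form the terms of a mixture. *)
Definition weighted_measure (A : set Y) := \int[mu]_(x in phi @^-1` A) (g x)%:E.

Let mpre A : measurable A -> measurable (phi @^-1` A).
Proof. by move=> mA; rewrite -(setTI (_ @^-1` _)); exact: mphi. Qed.

Local Notation m := weighted_measure.

Let m0 : m set0 = 0.
Proof. by rewrite /weighted_measure preimage_set0 integral_set0. Qed.

Let m_ge0 A : 0 <= m A.
Proof. by apply: integral_ge0 => x _; rewrite lee_fin. Qed.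

Let m_sigma_additive : semi_sigma_additive m.
Proof.
move=> F mF tF mUF; rewrite /weighted_measure preimage_bigcup.
apply: (@semi_sigma_additive_nng_induced _ _ _ mu (EFin \o g)) => //.
- exact/measurable_EFinP.
- by move=> n; exact: mpre.
- apply/trivIsetP => /= i j _ _ ij; rewrite -preimage_setI.
  by move/trivIsetP : tF => /(_ _ _ _ _ ij) ->//; rewrite preimage_set0.
- by rewrite -preimage_bigcup; exact: mpre.
Qed.

HB.instance Definition _ := isMeasure.Build _ _ _ weighted_measure
  m0 m_ge0 m_sigma_additive.

Import HBNNSimple.

Let mge : measurable_fun [set: X] (EFin \o g).
Proof. exact/measurable_EFinP. Qed.

Let ge0 x : 0 <= (g x)%:E.
Proof. by rewrite lee_fin. Qed.

(** Change of variables, by monotone convergence from simple functions; for the indicator of a level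
    set it is the definition of the measure. *)
Let integral_m (f : Y -> \bar R) :
  measurable_fun [set: Y] f -> (forall y, 0 <= f y) ->
  \int[m]_y f y = \int[mu]_x ((g x)%:E * f (phi x)).
Proof.
move=> mf f0; pose f_ := nnsfun_approx measurableT mf.
have cvgf y : (EFin \o f_ ^~ y) n @[n --> \oo] --> f y.
  by apply: cvg_nnsfun_approx => // ? _; exact: f0.
have ndf y i j : (i <= j)%N -> (f_ i y <= f_ j y)%R.
  by move=> ij; exact/lefP/nd_nnsfun_approx.
have mfphi n : measurable_fun [set: X] (fun x => (f_ n (phi x))%:E).
  by apply/measurable_EFinP; apply: measurableT_comp => //.
transitivity (limn (fun n => \int[m]_y (f_ n y)%:E)).
  rewrite -monotone_convergence//.
  - by apply: eq_integral => y _; apply/esym/cvg_lim => //; exact: cvgf.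
  - by move=> n; exact/measurable_EFinP/measurable_funP.
  - by move=> n y _; rewrite lee_fin.
  - by move=> y _ i j ij; rewrite lee_fin ndf.
transitivity (limn (fun n => \int[mu]_x ((g x)%:E * (f_ n (phi x))%:E))); last first.
  rewrite -monotone_convergence//.
  - apply: eq_integral => x _; apply/cvg_lim => //.
    by apply: cvgeZl => //; exact: cvgf.
  - by move=> n; apply: emeasurable_funM.
  - by move=> n x _; rewrite mule_ge0// lee_fin.
  - by move=> x _ i j ij; rewrite lee_wpmul2l// lee_fin ndf.
congr (limn _); apply/funext => n.
have mind k : measurable_fun [set: X] (fun x => \1_(f_ n @^-1` [set k]) (phi x) : R).
  by apply: (@measurableT_comp _ _ _ X Y R (\1_(f_ n @^-1` [set k])) _ phi) => //.
transitivity (\sum_(k \in range (f_ n))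
    \int[m]_y (k * \1_(f_ n @^-1` [set k]) y)%:E).
  under eq_integral do rewrite fimfunE -fsumEFin//.
  rewrite ge0_integral_fsum//.
  - by move=> k; exact/measurable_EFinP/measurable_funM.
  - by move=> k y _; rewrite nnfun_muleindic_ge0.
transitivity (\sum_(k \in range (f_ n))
    \int[mu]_x ((g x)%:E * (k * \1_(f_ n @^-1` [set k]) (phi x))%:E)); last first.
  rewrite -ge0_integral_fsum//.
  - apply: eq_integral => x _; rewrite [in RHS]fimfunE -fsumEFin//.
    by rewrite ge0_mule_fsumr// => k; rewrite nnfun_muleindic_ge0.
  - move=> k; apply: emeasurable_funM => //; apply/measurable_EFinP.
    exact: measurable_funM.
  - by move=> k x _; rewrite mule_ge0// nnfun_muleindic_ge0.
apply: eq_fsbigr => k /[!inE] -[y _ fk].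
rewrite integralZl_indic_nnsfun// integral_indic// setIT.
have k0 : (0 <= k)%R by rewrite -fk.
under eq_integral do rewrite EFinM muleCA.
rewrite ge0_integralZl//; last first.
- by move=> x _; rewrite mule_ge0// lee_fin.
- by apply: emeasurable_funM => //; exact/measurable_EFinP.
congr (_ * _); transitivity (m (f_ n @^-1` [set k])) => //.
rewrite /weighted_measure integral_mkcond; apply: eq_integral => x _.
rewrite patchE indicE; case: ifPn => xk.
  by rewrite (_ : (phi x \in _) = true) ?mule1//; rewrite !inE in xk *.
rewrite (_ : (phi x \in _) = false) ?mule0//; apply/negbTE; move: xk.
by rewrite !notin_setE.
Qed.

Lemma weighted_pushforward : exists nu : {measure set Y -> \bar R},
  forall f : Y -> \bar R, measurable_fun [set: Y] f -> (forall y, 0 <= f y) ->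
  \int[nu]_y f y = \int[mu]_x ((g x)%:E * f (phi x)).
Proof. by exists m; exact: integral_m. Qed.

End weighted_pushforward.

Section rkhs_measurable.
Context {R : realType} {T : Type}.
Implicit Types (H : rkhs R T).

Local Notation fun_space H := (g_sigma_algebraType (rkhs_open H)).

Lemma rkhs_open_measurable H (A : set (fun_space H)) :
  rkhs_open H A -> measurable A.
Proof. by move=> oA; exact: sub_sigma_algebra. Qed.

Lemma measurable_carrier H : measurable (carrier H : set (fun_space H)).
Proof. by apply: rkhs_open_measurable => f Hf _; exists 1. Qed.

Lemma rkhs_open_preimage H0 H (phi : fun_space H0 -> fun_space H) :
  (forall A : set (fun_space H), rkhs_open H A -> rkhs_open H0 (phi @^-1` A)) ->
  measurable_fun [set: _] phi.
Proof.
move=> h.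
apply: (@measurability _ _ (fun_space H0) (fun_space H) setT phi (rkhs_open H) erefl).
move=> _ [A oA <-].
by rewrite setTI; apply: rkhs_open_measurable; exact: h.
Qed.

(** Evaluations are continuous on [H], and [rkhs_open] asks nothing off the carrier, so that their
    superlevel sets are generators of the sigma-algebra. *)
Lemma measurable_eval H x : measurable_fun [set: _] (fun h : fun_space H => h x).
Proof.
apply: (measurability _ (RGenOInfty.measurableE R)) => _ [_ [a ->] <-].
rewrite setTI; apply: rkhs_open_measurable => f Hf; rewrite /= in_itv/= andbT => fa.
have k0 : 0 < Num.sqrt (kern H x x) + 1 by rewrite ltr_wpDl// sqrtr_ge0.
exists ((f x - a) / (Num.sqrt (kern H x x) + 1)).
  by rewrite divr_gt0// subr_gt0.
move=> g Hg; have Hgf := carrierB Hg Hf.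
rewrite rkhs_normE// lte_fin ltr_pdivlMr// => gf.
have := rnorm_eval x Hgf; rewrite -[(g - f) x]/(g x - f x) => h.
have {}gf : `|g x - f x| < f x - a.
  apply: le_lt_trans h _; apply: le_lt_trans gf.
  by rewrite ler_wpM2l ?rnorm_ge0// lerDl.
by move: gf; rewrite /= in_itv/= andbT ltr_norml => /andP[? ?]; lra.
Qed.

Lemma measurable_rkhs_norm H :
  measurable_fun [set: _] (rkhs_norm H : fun_space H -> \bar R).
Proof.
apply: (measurability _ (ErealGenOInfty.measurableE R)) => _ [_ [a ->] <-].
rewrite setTI; apply: rkhs_open_measurable => f Hf.
rewrite /= in_itv/= andbT rkhs_normE// lte_fin => fa.
exists (rnorm H f - a); first by rewrite subr_gt0.
move=> g Hg; have Hgf := carrierB Hg Hf.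
rewrite rkhs_normE// lte_fin => gf.
rewrite /= in_itv/= andbT rkhs_normE// lte_fin.
have := rnormD_le Hg (carrierZ (-1) Hgf).
rewrite rnormZ// normrN1 mul1r scaleN1r opprB addrC subrK.
by lra.
Qed.

(** A bounded linear map from [H0] to [H] pulls sets open in [H] back to sets open in [H0]; this is
    what allows measures to change spaces. *)
Lemma measurable_scale H0 H (s M : R) : 0 <= M ->
  (forall f, carrier H0 f ->
    carrier H (s *: f) /\ rnorm H (s *: f) <= M * rnorm H0 f) ->
  measurable_fun [set: _] (fun h : fun_space H0 => s *: h : fun_space H).
Proof.
move=> M0 sM; apply: rkhs_open_preimage => A oA f Hf /= Af.
have [e e0 eA] := oA _ (sM f Hf).1 Af.
have M10 : 0 < M + 1 by rewrite ltr_wpDl.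
exists (e / (M + 1)); first by rewrite divr_gt0.
move=> g Hg; have Hgf := carrierB Hg Hf.
rewrite rkhs_normE// lte_fin ltr_pdivlMr// => gf; apply: eA.
  by have [] := sM g Hg.
have [Hs les] := sM _ Hgf; rewrite -scalerBr rkhs_normE// lte_fin.
apply: le_lt_trans les _; apply: le_lt_trans gf.
by rewrite mulrC ler_wpM2l ?rnorm_ge0// lerDl.
Qed.

Lemma rkhs_norm_ge0 H f : (0 <= rkhs_norm H f)%E.
Proof. by rewrite /rkhs_norm; case: ifPn => // _; rewrite lee_fin sqrtr_ge0. Qed.

End rkhs_measurable.

Lemma measure_probT d (T : measurableType d) (R : realType) (P : probability T R) :
  (P : {measure set T -> \bar R}) setT = 1%E.
Proof. exact: probability_setT. Qed.

(** * Comparison of Lp norms on a probability space *)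

Section Lnorm_probability.
Local Open Scope ereal_scope.
Context d (T : measurableType d) (R : realType).
Implicit Types (P : probability T R) (f : T -> \bar R) (B r : R) (p : \bar R).

Lemma le_poweR (x y : \bar R) r : (0 <= r)%R -> 0 <= x -> x <= y ->
  x `^ r <= y `^ r.
Proof.
move=> r0 x0 xy; apply: gt0_ler_poweR => //; rewrite in_itv/= leey andbT//.
exact: le_trans xy.
Qed.

Lemma Lnorm_finleP P f r B : (0 < r)%R -> (0 <= B)%R ->
  ('N[P]_r%:E[f] <= B%:E) = (\int[P]_x (`|f x| `^ r) <= (B `^ r)%:E).
Proof.
move=> r0 B0; have rn0 : r != 0%R by rewrite gt_eqF.
have I0 : 0 <= \int[P]_x (`|f x| `^ r).
  by apply: integral_ge0 => x _; exact: poweR_ge0.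
apply/idP/idP => h.
  rewrite -(poweR_Lnorm P f rn0) -poweR_EFin.
  by rewrite le_poweR ?Lnorm_ge0// ltW.
have -> : B%:E = (B `^ r)%:E `^ r^-1.
  by rewrite poweR_EFin -powRrM divff// powRr1.
by rewrite unlock le_poweR// invr_ge0 ltW.
Qed.

Lemma Lnorm_inftyleP P f y : ('N[P]_+oo[f] <= y) <-> {ae P, forall x, `|f x| <= y}.
Proof.
by rewrite unlock (measure_probT P) lte01; split => /ess_supP.
Qed.

(* Young's inequality for (t / B) ^ r times 1, with exponent s / r. *)
Lemma powR_young_le (t B r s : R) : (0 < r < s)%R -> (0 < B)%R -> (0 <= t)%R ->
  (t `^ r <= B `^ r * (r / s * B `^ (- s)) * t `^ s + B `^ r * (1 - r / s))%R.
Proof.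
move=> /andP[r0 rs] B0 t0; have s0 := lt_trans r0 rs.
have rs1 : (r / s < 1)%R by rewrite ltr_pdivrMr// mul1r.
have := (@conjugate_powR R ((t / B) `^ r) 1 (s / r) ((1 - r / s)^-1))%R.
rewrite powR1 !powR_ge0 ler01 divr_gt0// invr_gt0 subr_gt0 rs1 invf_div invrK.
rewrite subrKC !mulr1 mul1r => /(_ isT isT isT isT erefl).
rewrite -powRrM (mulrC r) divfK ?gt_eqF//.
have tB u : ((t / B) `^ u = t `^ u / B `^ u)%R.
  rewrite powRM ?invr_ge0 ?(ltW B0)// -powRN.
  by rewrite -(powR_inv1 (ltW B0)) -powRrM mulN1r.
rewrite !tB powRN ler_pdivrMr ?powR_gt0// => /le_trans; apply.
by rewrite le_eqVlt; apply/orP; left; apply/eqP; ring.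
Qed.

(** It suffices to consider real bounds [B] on the larger norm. For finite [q] the pointwise
    inequality normalized by [B] is integrated, and its two terms contribute the fractions [r / s]
    and [1 - r / s] of [B ^ r]; for infinite [q] the function is almost everywhere at most [B]. *)
Lemma le_Lnorm_probability P f p q : measurable_fun [set: T] f ->
  0 < p -> p <= q -> 'N[P]_p[f] <= 'N[P]_q[f].
Proof.
move=> mf p0 pq.
suff le B : (0 < B)%R -> 'N[P]_q[f] <= B%:E -> 'N[P]_p[f] <= B%:E.
  have [->|] := eqVneq ('N[P]_q[f]) +oo; first by rewrite leey.
  rewrite -ltey => Nq; have N0 := Lnorm_ge0 P q f.
  have Nfin : 'N[P]_q[f] \is a fin_num by rewrite ge0_fin_numE.
  apply/lee_addgt0Pr => e e0; rewrite -(fineK Nfin) -EFinD.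
  by apply: le; rewrite ?ltr_wpDl ?fine_ge0// EFinD fineK// leeDl// lee_fin ltW.
move=> B0; move: q pq => [s| |]; last by rewrite leeNy_eq => /eqP pN; rewrite pN in p0.
- case: p p0 => [r| |]//; rewrite !lte_fin lee_fin => r0; rewrite le_eqVlt.
  move=> /predU1P[->//|rs]; have s0 := lt_trans r0 rs.
  rewrite !Lnorm_finleP ?(ltW B0)// => h.
  pose c1 := (B `^ r * (r / s * B `^ (- s)))%R.
  pose c2 := (B `^ r * (1 - r / s))%R.
  have rs1 : (r / s < 1)%R by rewrite ltr_pdivrMr// mul1r.
  have c10 : (0 <= c1)%R by rewrite !mulr_ge0 ?powR_ge0 ?invr_ge0// ltW.
  have c20 : (0 <= c2)%R by rewrite mulr_ge0 ?powR_ge0// subr_ge0 ltW.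
  have mfs u : measurable_fun [set: T] (fun x => `|f x| `^ u).
    apply: (measurableT_comp (measurable_poweR u)).
    exact: (measurableT_comp (@abse_measurable _ _)).
  apply: (@le_trans _ _ (\int[P]_x (c1%:E * (`|f x| `^ s) + c2%:E))).
    apply: ge0_le_integral => //.
    - by move=> x _; exact: poweR_ge0.
    - by apply: emeasurable_funD => //; apply: emeasurable_funM.
    - move=> x _; case: (f x) => [t| |]; rewrite [`|_|]/=.
      + by rewrite !poweR_EFin -EFinM -EFinD lee_fin powR_young_le// r0.
      + by rewrite !poweRyr ?gt_eqF// gt0_muley ?addye ?leey// lte_fin
          !mulr_gt0 ?powR_gt0 ?invr_gt0.
      + by rewrite !poweRyr ?gt_eqF// gt0_muley ?addye ?leey// lte_fin
          !mulr_gt0 ?powR_gt0 ?invr_gt0.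
  rewrite ge0_integralD//; last 2 first.
  - by move=> x _; rewrite mule_ge0// ?poweR_ge0// lee_fin.
  - by apply: emeasurable_funM.
  rewrite ge0_integralZl//; last by move=> x _; exact: poweR_ge0.
  rewrite integral_cst// (measure_probT P) mule1.
  apply: (@le_trans _ _ (c1%:E * (B `^ s)%:E + c2%:E)).
    by rewrite leeD2r// lee_wpmul2l.
  rewrite -EFinM -EFinD lee_fin /c1 /c2 -!mulrA -powRD ?addNr ?powRr0; last first.
    by rewrite (gt_eqF B0) implybT.
  by rewrite mulr1 -mulrDr subrKC mulr1.
- move=> _; case: p p0 => [r| |]// r0 /Lnorm_inftyleP h.
  rewrite Lnorm_finleP ?(ltW B0)//.
  apply: (@le_trans _ _ (\int[P]_x (B `^ r)%:E)); last first.
    by rewrite integral_cst// (measure_probT P) mule1.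
  apply: ae_ge0_le_integral => //.
  - by move=> x _; exact: poweR_ge0.
  - apply: (measurableT_comp (measurable_poweR r)).
    exact: (measurableT_comp (@abse_measurable _ _)).
  - by move=> x _; rewrite lee_fin powR_ge0.
  - apply: filterS h => x h _; rewrite -poweR_EFin.
    by rewrite le_poweR// ltW.
Qed.

End Lnorm_probability.

(** * Measures with a prescribed kernel *)

Section probability_of_measure.
Local Open Scope ereal_scope.
Context d (T : measurableType d) (R : realType).
Variables (mu : {measure set T -> \bar R}) (mu1 : mu setT = 1).

Definition as_probability of mu setT = 1 : set T -> \bar R := mu.

HB.instance Definition _ := Measure.on (as_probability mu1).
HB.instance Definition _ :=
  Measure_isProbability.Build _ _ _ (as_probability mu1) mu1.

Lemma probability_of_measure : exists P : probability T R,
  forall f : T -> \bar R, \int[P]_x f x = \int[mu]_x f x.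
Proof. by exists (as_probability mu1) => f; exact: eq_measure_integral. Qed.

End probability_of_measure.

Section probability_constructions.
Local Open Scope ereal_scope.
Context {R : realType}.

Lemma reweighted_probability d1 d2 (X : measurableType d1)
    (Y : measurableType d2) (mu : {measure set X -> \bar R}) (g : X -> R)
    (phi : X -> Y) :
  measurable_fun [set: X] g -> (forall x, (0 <= g x)%R) ->
  measurable_fun [set: X] phi -> \int[mu]_x (g x)%:E = 1 ->
  exists P : probability Y R, forall f : Y -> \bar R,
    measurable_fun [set: Y] f -> (forall y, 0 <= f y) ->
    \int[P]_y f y = \int[mu]_x ((g x)%:E * f (phi x)).
Proof.
move=> mg g0 mphi g1.
have [nu nuE] := weighted_pushforward mu mg g0 mphi.
have [|P PE] := @probability_of_measure _ _ _ nu.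
  have := nuE (cst 1) (measurable_cst _) (fun=> lee01).
  rewrite integral_cst// mul1e => ->; rewrite -[RHS]g1.
  by apply: eq_integral => x _; rewrite mule1.
by exists P => f mf f0; rewrite PE nuE.
Qed.

(** The exponent [n.+1] makes the weights sum to 1 from [n = 0] on. *)
Definition half (n : nat) : R := (2^-1) ^+ n.+1.

Lemma half_gt0 n : (0 < half n)%R.
Proof. by rewrite exprn_gt0// invr_gt0. Qed.

Lemma cvg_half : series half @ \oo --> (1 : R)%R.
Proof.
have := @cvg_geometric_series R (2^-1) (2^-1).
rewrite ger0_norm ?invr_ge0// invf_lt1 ?ltr1n// => /(_ isT).
rewrite [X in _ --> X](_ : _ = 1%R); last by field.
apply: cvg_trans; rewrite (_ : series half = series (geometric 2^-1 2^-1))%R//.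
by congr series; apply/funext => n; rewrite /half exprS.
Qed.

Lemma eseries_EFin (u : R^nat) (l : R) : series u @ \oo --> l ->
  \sum_(n <oo) (u n)%:E = l%:E.
Proof.
move=> ul; apply/cvg_lim => //; rewrite (_ : (fun n => _) = EFin \o series u).
  by apply: cvg_EFin; [exact: nearW|exact: ul].
by apply/funext => n; rewrite /= sumEFin.
Qed.

(** The components live on different measurable spaces, one for each RKHS; each is pushed to [Y]
    before the sum is taken. *)
Lemma mixture_probability (d_ : nat -> measure_display)
    (X_ : forall n, measurableType (d_ n)) d (Y : measurableType d)
    (mu_ : forall n, probability (X_ n) R) (phi_ : forall n, X_ n -> Y) :
  (forall n, measurable_fun [set: X_ n] (phi_ n)) ->
  exists P : probability Y R, forall f : Y -> \bar R,
    measurable_fun [set: Y] f -> (forall y, 0 <= f y) ->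
    \int[P]_y f y = \sum_(n <oo) (half n)%:E * \int[mu_ n]_x f (phi_ n x).
Proof.
move=> mphi.
have /choice[nu_ nuE] : forall n, exists nu : {measure set Y -> \bar R},
    forall f : Y -> \bar R, measurable_fun [set: Y] f -> (forall y, 0 <= f y) ->
    \int[nu]_y f y = \int[mu_ n]_x ((half n)%:E * f (phi_ n x)).
  move=> n; apply: (weighted_pushforward (mu_ n) (measurable_cst (half n)) _ (mphi n)).
  by move=> x; rewrite ltW// half_gt0.
have {}nuE n (f : Y -> \bar R) : measurable_fun [set: Y] f -> (forall y, 0 <= f y) ->
    \int[nu_ n]_y f y = (half n)%:E * \int[mu_ n]_x f (phi_ n x).
  move=> mf f0; rewrite nuE// ge0_integralZl//.
  - exact: (measurableT_comp mf (mphi n)).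
  - by rewrite lee_fin ltW// half_gt0.
have mixE (f : Y -> \bar R) : measurable_fun [set: Y] f -> (forall y, 0 <= f y) ->
    \int[mseries nu_ 0]_y f y =
    \sum_(n <oo) (half n)%:E * \int[mu_ n]_x f (phi_ n x).
  move=> mf f0; rewrite ge0_integral_measure_series//.
  by apply: eq_eseriesr => n _; exact: nuE.
have [|P PE] := @probability_of_measure _ _ _ (mseries nu_ 0).
  have := mixE (cst 1) (measurable_cst _) (fun=> lee01).
  rewrite integral_cst// mul1e => ->.
  rewrite -[RHS](eseries_EFin cvg_half); apply: eq_eseriesr => n _.
  by rewrite integral_cst// mul1e measure_probT mule1.
by exists P => f mf f0; rewrite PE mixE.
Qed.

End probability_constructions.

Section ae_probability.
Context d (T : measurableType d) (R : realType) (P : probability T R).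

Lemma ae_imply (A B : T -> Prop) : (forall x, A x -> B x) ->
  {ae P, forall x, A x} -> {ae P, forall x, B x}.
Proof. by move=> AB; apply: filterS. Qed.

Lemma ae_imply2 (A B C : T -> Prop) : (forall x, A x -> B x -> C x) ->
  {ae P, forall x, A x} -> {ae P, forall x, B x} -> {ae P, forall x, C x}.
Proof. by move=> ABC; apply: filterS2. Qed.

(** Full measure is tested by an integral because the probabilities constructed above are described
    by their integrals. *)
Lemma probability_full (A : set T) : measurable A ->
  (\int[P]_x (\1_(~` A) x)%:E <= 0)%E -> P A = 1%E.
Proof.
move=> mA; rewrite integral_indic//; last exact: measurableC.
rewrite setIT measure_le0 => /eqP P0.
rewrite -[A]setCK probability_setC; last exact: measurableC.
by rewrite P0 sube0.
Qed.

Lemma ae_indic (A : set T) : measurable A ->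
  (\int[P]_x (\1_A x)%:E <= 0)%E -> {ae P, forall x, ~ A x}.
Proof.
move=> mA; rewrite integral_indic// setIT measure_le0 => /eqP P0.
by exists A; split => // x /= /contrapT.
Qed.

End ae_probability.

Section steps.
Context {R : realType} {T : Type}.
Implicit Types (H : rkhs R T) (sigma : R -> R).
Local Notation fun_space H := (g_sigma_algebraType (rkhs_open H)).

Lemma concentrated_ae H (mu : rkhs_probability H) : concentrated mu ->
  {ae mu, forall h : T -> R, carrier H h}.
Proof.
move=> mu1; exists (~` carrier H); split => //.
  by apply: measurableC; exact: measurable_carrier.
rewrite probability_setC; last exact: measurable_carrier.
by rewrite mu1 subee.
Qed.

Lemma measurable_sqr_combination sigma H (a b : R) x y :
  measurable_fun [set: R] sigma ->
  measurable_fun [set: fun_space H]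
    (fun h : fun_space H => ((a * sigma (h x) + b * sigma (h y)) ^+ 2)%:E).
Proof.
move=> ms; apply/measurable_EFinP; apply: measurable_funX.
have me z : measurable_fun [set: fun_space H] (fun h : fun_space H => sigma (h z)).
  apply: (@measurableT_comp _ _ _ (fun_space H) _ _ _ _ (fun h => h z)) => //.
  exact: measurable_eval.
by apply: measurable_funD; apply: measurable_funM.
Qed.

Definition norm_gt H (B : R) : set (fun_space H) :=
  [set h | (B%:E < `|rkhs_norm H h|)%E].

Lemma measurable_norm_gt H B : measurable (norm_gt B : set (fun_space H)).
Proof.
have mn : measurable_fun [set: fun_space H] (fun h => `|rkhs_norm H h|)%E.
  apply: (@measurableT_comp _ _ _ (fun_space H) _ _ abse) => //.
  exact: measurable_rkhs_norm.
rewrite (_ : norm_gt B =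
    setT `&` (fun h => `|rkhs_norm H h|)%E @^-1` `]B%:E, +oo[%classic).
  by apply: mn => //; exact: emeasurable_itv.
by apply/seteqP; split => h; rewrite /norm_gt/= in_itv/= andbT// => -[].
Qed.

Lemma Lnorm_inftyle_indic H (P : rkhs_probability H) (B : R) :
  (\int[P]_h (\1_(norm_gt B) h)%:E <= 0)%E ->
  ('N[P]_+oo[rkhs_norm H] <= B%:E)%E.
Proof.
move=> /(ae_indic (@measurable_norm_gt H B)) h; apply/Lnorm_inftyleP.
by apply: ae_imply h => h Bh; rewrite leNgt; apply/negP.
Qed.

(* By polarization a kernel is determined by integrals of squares, so that only
   integrals of nonnegative functions have to be transported between measures. *)
Section squares.
Variables (sigma : R -> R) (H : rkhs R T) (mu : rkhs_probability H).
Let sq (a b : R) x y (h : T -> R) := (a * sigma (h x) + b * sigma (h y)) ^+ 2.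

Lemma has_kernel_of_sqr H' : has_kernel_of sigma mu H' -> forall a b x y,
  mu.-integrable setT (EFin \o sq a b x y) /\
  (\int[mu]_h (sq a b x y h)%:E =
   (a ^+ 2 * kern H' x x + 2 * a * b * kern H' x y + b ^+ 2 * kern H' y y)%:E)%E.
Proof.
move=> K a b x y.
have E : (EFin \o sq a b x y = (fun h : fun_space H =>
    (a ^+ 2)%:E * (sigma (h x) * sigma (h x))%:E +
    ((2 * a * b)%:E * (sigma (h x) * sigma (h y))%:E +
     (b ^+ 2)%:E * (sigma (h y) * sigma (h y))%:E)))%E.
  apply/funext => h; rewrite -!EFinM -!EFinD /sq /=; congr EFin; ring.
have I z t c : mu.-integrable setT
    (fun h : fun_space H => (c%:E * (sigma (h z) * sigma (h t))%:E)%E).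
  by apply: integrableZl => //; exact: (K z t).1.
rewrite E; split; first by apply: integrableD => //; exact: integrableD.
transitivity (\int[mu]_h (EFin \o sq a b x y) h)%E => //; rewrite E.
rewrite integralD//; last exact: integrableD.
rewrite integralD// !integralZl//; try exact: (K _ _).1.
by rewrite -!(K _ _).2 -!EFinM -!EFinD; congr EFin; ring.
Qed.

(** A product is a quarter of the difference of the squares of sum and difference. Integrability
    follows as well, since the squares have finite integrals. *)
Lemma sqr_has_kernel_of H' : measurable_fun [set: R] sigma ->
  (forall a b x y, \int[mu]_h (sq a b x y h)%:E =
   (a ^+ 2 * kern H' x x + 2 * a * b * kern H' x y + b ^+ 2 * kern H' y y)%:E)%E ->
  has_kernel_of sigma mu H'.
Proof.
move=> ms K x y.
have I a b : mu.-integrable setT (EFin \o sq a b x y).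
  apply/integrableP; split; first exact: measurable_sqr_combination.
  under eq_integral => h _ do rewrite /= ger0_norm ?sqr_ge0//.
  by rewrite K ltry.
have E : (fun h : fun_space H => (sigma (h x) * sigma (h y))%:E) =
    (fun h => 4^-1%:E * (EFin \o sq 1 1 x y) h +
              (- 4^-1)%:E * (EFin \o sq 1 (-1) x y) h)%E.
  by apply/funext => h; rewrite /sq /= -!EFinM -EFinD; congr EFin; field.
rewrite E; split.
  by apply: integrableD => //; exact: integrableZl.
rewrite integralD//; [|exact: integrableZl..].
by rewrite !integralZl// !K -!EFinM -EFinD; congr EFin; field.
Qed.

End squares.

(** A witness with a real bound in place of the infimum [step_cost]; every strict bound on the cost
    provides one. *)
Definition step_le sigma p H H' (B : R) : Prop :=
  exists mu : rkhs_probability H, [/\ concentrated mu,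
    has_kernel_of sigma mu H' & ('N[mu]_p[rkhs_norm H] <= B%:E)%E].

Lemma measurable_Lnorm_power H (r : R) :
  measurable_fun [set: fun_space H] (fun h => (`|rkhs_norm H h| `^ r)%E).
Proof.
apply: (@measurableT_comp _ _ _ (fun_space H) _ _ (fun y : \bar R => (`|y| `^ r)%E)).
  exact: (measurableT_comp (measurable_poweR r) (@abse_measurable _ _)).
exact: measurable_rkhs_norm.
Qed.

Section mixture_step.
Variables (sigma : R -> R) (p : \bar R) (H H' : rkhs R T).
Variables (H_ H'_ : nat -> rkhs R T) (s : nat -> R) (M B : R).
Hypotheses (ms : measurable_fun [set: R] sigma) (p0 : (0 < p)%E).
Hypotheses (M0 : 0 <= M) (B0 : 0 <= B).
Hypothesis s_sigma : forall n u, sigma (s n * u) = s n * sigma u.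
Hypothesis sM : forall n f, carrier (H_ n) f ->
  carrier H (s n *: f) /\ rnorm H (s n *: f) <= M * rnorm (H_ n) f.
Hypothesis steps : forall n, step_le sigma p (H_ n) (H'_ n) B.
Hypothesis kern_series : forall x y,
  series (fun n => half n * s n ^+ 2 * kern (H'_ n) x y) @ \oo --> kern H' x y.

(** The [n]-th measure is dilated by [s n], which multiplies its kernel by [s n ^+ 2] and brings it
    into [H] with norm bound [M * B]; the mixture has weights [half n]. The dilations [s n = 1]
    serve an arbitrary measurable activation, the others a homogeneous one. *)
Let mixture_of_measures (mu_ : forall n, rkhs_probability (H_ n)) :
  (forall n, concentrated (mu_ n)) ->
  (forall n, has_kernel_of sigma (mu_ n) (H'_ n)) ->
  (forall n, ('N[mu_ n]_p[rkhs_norm (H_ n)] <= B%:E)%E) ->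
  step_le sigma p H H' (M * B).
Proof.
move=> mu_conc mu_kern mu_norm.
have mphi n := measurable_scale M0 (@sM n).
have compR (g : fun_space H -> R) : measurable_fun setT g -> forall n,
    measurable_fun [set: fun_space (H_ n)] (fun h => g (s n *: h)).
  by move=> mg n; exact: (measurableT_comp mg (mphi n)).
have compE (g : fun_space H -> \bar R) : measurable_fun setT g -> forall n,
    measurable_fun [set: fun_space (H_ n)] (fun h => g (s n *: h)).
  by move=> mg n; exact: (measurableT_comp mg (mphi n)).
have [P PE] := mixture_probability mu_ mphi.
(* A bound common to all components passes to the mixture, as the weights sum to 1. *)
have P_le (F : fun_space H -> \bar R) (C : R) : measurable_fun setT F ->
    (forall h, (0 <= F h)%E) ->
    (forall n, (\int[mu_ n]_h F (s n *: h) <= C%:E)%E) ->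
    (\int[P]_h F h <= C%:E)%E.
  move=> mF F0 FC; rewrite PE//.
  have <- : (\sum_(n <oo) (half n * C)%:E = C%:E)%E.
    apply: eseries_EFin; rewrite -[X in _ --> X]mul1r.
    rewrite (_ : series _ = (fun n => series (@half R) n * C)).
      by apply: cvgMl; exact: cvg_half.
    by apply/funext => n; rewrite /series/= mulr_suml.
  apply: lee_nneseries => [n _|n _].
    by rewrite mule_ge0 ?integral_ge0// lee_fin ltW// half_gt0.
  by rewrite EFinM lee_wpmul2l// lee_fin ltW// half_gt0.
have ae n : {ae mu_ n, forall h : T -> R, carrier (H_ n) h}.
  exact: concentrated_ae.
have mC : measurable (carrier H : set (fun_space H)) by exact: measurable_carrier.
exists P; split.
- apply: probability_full => //.
  have mCC : measurable (~` carrier H : set (fun_space H)) by exact: measurableC.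
  apply: P_le => //.
    - by apply/measurable_EFinP; exact: measurable_indic.
    - move=> n; apply: (@le_trans _ _ (\int[mu_ n]_h 0)%E); last by rewrite integral0.
      apply: ae_ge0_le_integral => //.
      + apply/measurable_EFinP.
        apply: (compR (\1_(~` carrier H))).
        exact: measurable_indic.
      + apply: (ae_imply _ (ae n)) => h Hh _; rewrite indicE memNset//.
        by move=> /(_ (sM Hh).1).
- apply: sqr_has_kernel_of => // a b x y; rewrite PE; last 2 first.
  + exact: measurable_sqr_combination.
  + by move=> h; rewrite lee_fin sqr_ge0.
  rewrite (eq_eseriesr (g := fun n => (half n * s n ^+ 2 *
      (a ^+ 2 * kern (H'_ n) x x + 2 * a * b * kern (H'_ n) x y +
       b ^+ 2 * kern (H'_ n) y y))%:E)); last first.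
    move=> n _; have [I E] := has_kernel_of_sqr (mu_kern n) a b x y.
    rewrite -mulrA EFinM; congr (_ * _)%E; rewrite EFinM -E -integralZl//.
    apply: eq_integral => h _; rewrite -EFinM; congr EFin.
    by rewrite -[(s n *: h) x]/(s n * h x) -[(s n *: h) y]/(s n * h y) !s_sigma; ring.
  apply: eseries_EFin.
  rewrite (_ : series _ = (fun n =>
    a ^+ 2 * series (fun n => half n * s n ^+ 2 * kern (H'_ n) x x) n +
    2 * a * b * series (fun n => half n * s n ^+ 2 * kern (H'_ n) x y) n +
    b ^+ 2 * series (fun n => half n * s n ^+ 2 * kern (H'_ n) y y) n)).
    apply: cvgD; first apply: cvgD; by apply: cvgMr; exact: kern_series.
  apply/funext => n; rewrite /series/= !mulr_sumr -!big_split/=.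
  by apply: eq_bigr => i _; ring.
have MB0 : 0 <= M * B by rewrite mulr_ge0.
have norm_le n : {ae mu_ n, forall h,
    (rkhs_norm H (s n *: h) <= M%:E * rkhs_norm (H_ n) h)%E}.
  apply: (ae_imply _ (ae n)) => h Hh; have [Hs sle] := sM Hh.
  by rewrite !rkhs_normE.
case: p p0 mu_norm => [r| |]// r0 mu_norm.
- rewrite Lnorm_finleP// powRM//.
  apply: P_le => [|h|n]; first exact: measurable_Lnorm_power.
    exact: poweR_ge0.
  apply: (@le_trans _ _ (\int[mu_ n]_h ((M `^ r)%:E * `|rkhs_norm (H_ n) h| `^ r)))%E.
    apply: ae_ge0_le_integral => //.
    + by move=> h _; exact: poweR_ge0.
    + apply: (compE (fun h => (`|rkhs_norm H h| `^ r)%E)).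
      exact: measurable_Lnorm_power.
    + by move=> h _; rewrite mule_ge0 ?poweR_ge0// lee_fin powR_ge0.
    + by apply: emeasurable_funM => //; exact: measurable_Lnorm_power.
    + apply: (ae_imply _ (norm_le n)) => h nle _.
      rewrite -poweR_EFin -poweRM ?lee_fin// le_poweR//; first exact: ltW.
      by rewrite !gee0_abs ?rkhs_norm_ge0.
  rewrite ge0_integralZl//; last 3 first.
  + exact: measurable_Lnorm_power.
  + by move=> h _; exact: poweR_ge0.
  + by rewrite lee_fin powR_ge0.
  rewrite EFinM lee_wpmul2l ?lee_fin ?powR_ge0//.
  by rewrite -Lnorm_finleP.
- apply: Lnorm_inftyle_indic; have mA := @measurable_norm_gt H (M * B).
  apply: P_le => //; first by apply/measurable_EFinP; exact: measurable_indic.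
  move=> n; apply: (@le_trans _ _ (\int[mu_ n]_h 0)%E); last by rewrite integral0.
  apply: ae_ge0_le_integral => //.
    apply/measurable_EFinP.
    apply: (compR (\1_(norm_gt (M * B)))).
    exact: measurable_indic.
  have /Lnorm_inftyleP nB := mu_norm n.
  apply: (ae_imply2 _ (norm_le n) nB) => h h1 h2 _; rewrite indicE memNset//.
  apply/negP; rewrite -leNgt.
  rewrite gee0_abs ?rkhs_norm_ge0//; apply: le_trans h1 _.
  rewrite EFinM lee_wpmul2l ?lee_fin//.
  by apply: le_trans h2; rewrite lee_abs.
Qed.

Lemma mixture_step : step_le sigma p H H' (M * B).
Proof.
by apply: (@mixture_of_measures (fun n => sval (cid (steps n)))) => n;
  case: (svalP (cid (steps n))).
Qed.

End mixture_step.

End steps.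

Section step_lemmas.
Context {R : realType} {T : Type}.
Implicit Types (H : rkhs R T) (sigma : R -> R).
Local Notation fun_space H := (g_sigma_algebraType (rkhs_open H)).

Lemma step_cost_le sigma p H H' B : step_le sigma p H H' B ->
  (step_cost sigma p H H' <= B%:E)%E.
Proof.
by move=> [mu [mu1 muk muB]]; apply: le_trans muB; apply: ereal_inf_lbound; exists mu.
Qed.

Lemma step_cost_lt sigma p H H' B : (step_cost sigma p H H' < B%:E)%E ->
  step_le sigma p H H' B.
Proof.
move=> /ereal_inf_lt[_ [mu [mu1 muk] <-] muB].
by exists mu; split => //; exact: ltW.
Qed.

Lemma step_cost_ge0 sigma p H H' : (0 <= step_cost sigma p H H')%E.
Proof. by apply: le_ereal_inf_tmp => _ [mu _ <-]; exact: Lnorm_ge0. Qed.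

Lemma step_le_mono sigma p q H H' B : (0 < p)%E -> (p <= q)%E ->
  step_le sigma q H H' B -> step_le sigma p H H' B.
Proof.
move=> p0 pq [mu [mu1 muk muB]]; exists mu; split => //.
apply: le_trans muB; apply: le_Lnorm_probability => //.
exact: measurable_rkhs_norm.
Qed.

Lemma sqr_norm_poweR H h : carrier H h ->
  (`|rkhs_norm H h| `^ 2)%E = (rnorm H h ^+ 2)%:E.
Proof.
move=> Hh; rewrite gee0_abs ?rkhs_norm_ge0// rkhs_normE// poweR_EFin.
by rewrite -powR_mulrn ?rnorm_ge0.
Qed.

(** A pointwise quadratic bound is integrated against a measure of L2 norm at most [B]. The
    coefficients (1, 0) give the diagonal of the kernel, and (1, -1) its squared distance. *)
Lemma step_growth sigma p H H' B (a b C : R) x y : (2%:E <= p)%E ->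
  0 <= B -> 0 <= C ->
  step_le sigma p H H' B ->
  (forall h, carrier H h ->
    (a * sigma (h x) + b * sigma (h y)) ^+ 2 <= C * rnorm H h ^+ 2) ->
  a ^+ 2 * kern H' x x + 2 * a * b * kern H' x y + b ^+ 2 * kern H' y y <=
  C * B ^+ 2.
Proof.
move=> p2 B0 C0 st hC.
have [|mu [mu1 muk muB]] := step_le_mono _ p2 st; first by rewrite lte_fin.
have [I E] := has_kernel_of_sqr muk a b x y.
rewrite -lee_fin -E.
apply: (@le_trans _ _ (\int[mu]_h (C%:E * `|rkhs_norm H h| `^ 2))%E).
  apply: ae_ge0_le_integral => //.
  - by move=> h _; rewrite lee_fin sqr_ge0.
  - by case/integrableP : I.
  - by move=> h _; rewrite mule_ge0 ?poweR_ge0// lee_fin.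
  - by apply: emeasurable_funM => //; exact: measurable_Lnorm_power.
  - apply: (ae_imply _ (concentrated_ae mu1)) => h Hh _.
    by rewrite sqr_norm_poweR// -EFinM lee_fin hC.
rewrite ge0_integralZl//; last 2 first.
- exact: measurable_Lnorm_power.
- by move=> h _; exact: poweR_ge0.
rewrite EFinM lee_wpmul2l ?lee_fin// -[B ^+ 2]powR_mulrn//.
by rewrite -Lnorm_finleP.
Qed.

Lemma carrier0 H : carrier H 0.
Proof. exact: (carrier_subspace H).1. Qed.

Lemma rnorm0 H : rnorm H 0 = 0.
Proof. by rewrite -(scale0r 0) rnormZ ?normr0 ?mul0r//; exact: carrier0. Qed.

Lemma rnorm_eq0 H h : carrier H h -> rnorm H h = 0 -> h = 0.
Proof.
move=> Hh h0; apply: (inner_definite Hh).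
by rewrite -sqr_rnorm// h0 expr0n.
Qed.

(** The measure is the Dirac mass at the zero function, which has norm 0. It provides a ladder of
    finite cost for every activation. *)
Lemma dirac_step sigma p H H' : measurable_fun [set: R] sigma -> (0 < p)%E ->
  (forall x y, kern H' x y = sigma 0 * sigma 0) -> step_le sigma p H H' 0.
Proof.
move=> ms p0 kH'; apply: (@step_le_mono _ _ +oo) => //; first exact: leey.
pose P : rkhs_probability H := dirac (0 : fun_space H).
have PE (f : fun_space H -> \bar R) : measurable_fun setT f ->
    (\int[P]_h f h)%E = f (0 : T -> R).
  by move=> mf; rewrite integral_dirac// diracT mul1e.
exists P; split.
- by rewrite /concentrated /P/= diracE mem_set//; exact: carrier0.
- apply: sqr_has_kernel_of => // a b x y; rewrite PE.
    by rewrite !kH' -[0 x]/(0 : R) -[0 y]/(0 : R); congr EFin; ring.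
  exact: measurable_sqr_combination.
- apply: Lnorm_inftyle_indic; rewrite PE; last first.
    by apply/measurable_EFinP; apply: measurable_indic; exact: measurable_norm_gt.
  rewrite indicE memNset// /norm_gt/= rkhs_normE ?rnorm0/= ?normr0 ?ltxx//.
  exact: carrier0.
Qed.

End step_lemmas.

(** * From an L2 bound to a sup bound *)

Section normalization.
Context {R : realType} {T : Type}.
Variables (sigma : R -> R) (H : rkhs R T).
Local Notation fun_space H := (g_sigma_algebraType (rkhs_open H)).

(** As [fine +oo = 0], this real-valued norm vanishes off the carrier. *)
Let rn (h : T -> R) : R := fine (rkhs_norm H h).

Let rnE h : carrier H h -> rn h = rnorm H h.
Proof. by move=> Hh; rewrite /rn rkhs_normE. Qed.

Let rn_ge0 h : 0 <= rn h.
Proof. by rewrite fine_ge0// rkhs_norm_ge0. Qed.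

Let rn_carrier h : rn h != 0 -> carrier H h.
Proof.
by apply: contra_neqP => nH; rewrite /rn /rkhs_norm asboolF.
Qed.

Let measurable_rn : measurable_fun [set: fun_space H] rn.
Proof.
apply: (@measurableT_comp _ _ _ (fun_space H) _ _ fine); first exact: fine_measurable.
exact: measurable_rkhs_norm.
Qed.

(* Since c / 0 = 0, this is 0 off the carrier and at 0. *)
Let normalize (c : R) (h : T -> R) : T -> R := (c / rn h) *: h.

Let normalize0 c h : rn h = 0 -> normalize c h = 0.
Proof. by move=> h0; rewrite /normalize h0 invr0 mulr0 scale0r. Qed.

Let carrier_normalize c h : carrier H (normalize c h).
Proof.
have [/normalize0 ->|/rn_carrier Hh] := eqVneq (rn h) 0; first exact: carrier0.
exact: carrierZ.
Qed.

Let rnorm_normalize c h : 0 <= c -> rnorm H (normalize c h) <= c.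
Proof.
move=> c0; have [/normalize0 ->|h0] := eqVneq (rn h) 0; first by rewrite rnorm0.
have Hh := rn_carrier h0.
rewrite rnormZ// ger0_norm ?divr_ge0// -rnE// divfK//.
Qed.

(** The difference is a multiple of [g - f] plus a correction for the change of norm; each part has
    norm at most [c / rnorm H f * rnorm H (g - f)]. *)
Let normalize_lipschitz c f g : 0 <= c -> carrier H f -> carrier H g ->
  0 < rnorm H f -> 0 < rnorm H g ->
  rnorm H (normalize c g - normalize c f) <= 2 * c / rnorm H f * rnorm H (g - f).
Proof.
move=> c0 Hf Hg f0 g0; rewrite /normalize !rnE//.
set nf := rnorm H f in f0 *; set ng := rnorm H g in g0 *.
have -> : (c / ng) *: g - (c / nf) *: f =
    (c / nf) *: (g - f) + (c * (nf - ng) / (nf * ng)) *: g.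
  rewrite scalerBr addrAC -scalerDl; congr (_ *: _ - _).
  by field; rewrite !gt_eqF.
have Hgf := carrierB Hg Hf.
apply: (le_trans (rnormD_le (carrierZ _ Hgf) (carrierZ _ Hg))).
rewrite !rnormZ// -/ng (@ger0_norm _ (c / nf)) ?divr_ge0//; last exact: ltW.
have fg : `|nf - ng| <= rnorm H (g - f).
  have h1 := rnormD_le Hf Hgf; rewrite addrC subrK in h1.
  have := rnormD_le Hg (carrierZ (-1) Hgf).
  rewrite rnormZ// normrN1 mul1r scaleN1r opprB addrC subrK => h2.
  by rewrite ler_norml; apply/andP; split; rewrite /nf /ng; lra.
rewrite (_ : `|c * (nf - ng) / (nf * ng)| * ng = c / nf * `|nf - ng|); last first.
  rewrite !normrM normfV normrM (gtr0_norm f0) (gtr0_norm g0) (ger0_norm c0).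
  by field; rewrite !gt_eqF.
apply: (@le_trans _ _ (c / nf * rnorm H (g - f) + c / nf * rnorm H (g - f))).
  by rewrite lerD2l ler_wpM2l// divr_ge0// ltW.
by rewrite le_eqVlt; apply/orP; left; apply/eqP; ring.
Qed.

(** Continuity may fail at 0, so the preimage of an open set is cut in two: its part where [rn] does
    not vanish is open, and on the measurable set where [rn] vanishes the map is constantly 0. *)
Let measurable_normalize c : 0 <= c ->
  measurable_fun [set: fun_space H] (normalize c : fun_space H -> fun_space H).
Proof.
move=> c0.
apply: (@measurability _ _ (fun_space H) (fun_space H) setT _ (rkhs_open H) erefl).
move=> _ [A oA <-]; rewrite setTI.
have mZ : measurable ([set h | rn h = 0] : set (fun_space H)).
  by have := measurable_rn measurableT (measurable_set1 0); rewrite setTI.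
have -> : normalize c @^-1` A =
    ((normalize c @^-1` A) `&` [set h | rn h <> 0]) `|`
    ([set h | rn h = 0] `&` [set _ | A 0]).
  apply/seteqP; split => h /=.
    by have [h0|/eqP] := eqVneq (rn h) 0; [right; rewrite -(normalize0 c h0)|left].
  by case=> -[] // h0 A0; rewrite normalize0.
apply: measurableU; last first.
  apply: measurableI => //; have [A0|nA0] := pselect (A 0).
    by rewrite (_ : [set _ | _] = setT)//; apply/seteqP; split.
  by rewrite (_ : [set _ | _] = set0)//; apply/seteqP; split.
apply: rkhs_open_measurable => f Hf [/= Af /eqP f0].
have nf0 : 0 < rnorm H f by rewrite -rnE// lt0r f0 rn_ge0.
have [e e0 eA] := oA _ (carrier_normalize c f) Af.
(* The first bound keeps [g] nonzero, the second accounts for the Lipschitz constant at [f]. *)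
pose d := Num.min (rnorm H f) (e / (2 * c / rnorm H f + 1)).
have k0 : 0 < 2 * c / rnorm H f + 1.
  by rewrite ltr_wpDl// divr_ge0 ?mulr_ge0// ltW.
exists d; first by rewrite lt_min nf0 divr_gt0.
move=> g Hg; have Hgf := carrierB Hg Hf.
rewrite rkhs_normE// lte_fin lt_min => /andP[gf1 gf2].
have ng0 : 0 < rnorm H g.
  have := rnormD_le Hg (carrierZ (-1) Hgf).
  by rewrite rnormZ// normrN1 mul1r scaleN1r opprB addrC subrK; lra.
split; last by rewrite rnE//; apply/eqP; rewrite gt_eqF.
apply: eA; first exact: carrier_normalize.
rewrite rkhs_normE ?lte_fin; last by apply: carrierB; exact: carrier_normalize.
apply: le_lt_trans (normalize_lipschitz c0 Hf Hg nf0 ng0) _.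
rewrite ltr_pdivlMr// mulrDr mulr1 mulrC in gf2.
by apply: le_lt_trans gf2; rewrite lerDl rnorm_ge0.
Qed.

Hypothesis sigma_homo : forall u a : R, 0 <= a -> sigma (a * u) = a * sigma u.
Hypothesis ms : measurable_fun [set: R] sigma.

(* Weighting mu by |h|^2 / c^2, where c is the L2 norm of mu, and rescaling each
   h to norm c leaves the kernel unchanged, since sigma(h x) sigma(h y) is
   2-homogeneous in h. *)
Lemma step_normalize H' (B : R) : 0 <= B ->
  step_le sigma 2%:E H H' B -> step_le sigma +oo H H' B.
Proof.
move=> B0 [mu [mu1 muk]]; rewrite Lnorm_finleP// powR_mulrn// => muB.
have s0 : sigma 0 = 0 by have := sigma_homo 0 (lexx 0); rewrite !mul0r.
have ae := concentrated_ae mu1.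
have mrn2 : measurable_fun [set: fun_space H] (fun h => rn h ^+ 2).
  exact: measurable_funX.
have IE : (\int[mu]_h (`|rkhs_norm H h| `^ 2) = \int[mu]_h (rn h ^+ 2)%:E)%E.
  apply: ge0_ae_eq_integral => //.
  - exact: measurable_Lnorm_power.
  - exact/measurable_EFinP.
  - by move=> h _; exact: poweR_ge0.
  - by move=> h _; rewrite lee_fin sqr_ge0.
  - by apply: (ae_imply _ ae) => h Hh _; rewrite sqr_norm_poweR// rnE.
have I0 : (0 <= \int[mu]_h (rn h ^+ 2)%:E)%E.
  by apply: integral_ge0 => h _; rewrite lee_fin sqr_ge0.
have Ifin : (\int[mu]_h (rn h ^+ 2)%:E)%E \is a fin_num.
  by rewrite ge0_fin_numE// -IE (le_lt_trans muB)// ltry.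
pose I := fine (\int[mu]_h (rn h ^+ 2)%:E)%E.
have II : (\int[mu]_h (rn h ^+ 2)%:E)%E = I%:E by rewrite fineK.
have I0' : 0 <= I by exact: fine_ge0.
have IB : I <= B ^+ 2 by rewrite -lee_fin -II -IE.
(* If [I = 0], the weight would divide by zero; but then [h = 0] almost surely and [mu] itself will
   do. *)
have [I00|In0] := eqVneq I 0.
  exists mu; split => //; apply/Lnorm_inftyleP.
  have : (\int[mu]_h `|(rn h ^+ 2)%:E| = 0)%E.
    by under eq_integral => h _ do rewrite gee0_abs ?lee_fin ?sqr_ge0//; rewrite II I00.
  move=> /ae_eq_integral_abs N0.
  have {}N0 : {ae mu, forall h, setT h -> (rn h ^+ 2)%:E = 0%E}.
    by apply: N0 => //; exact/measurable_EFinP.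
  apply: (ae_imply2 _ ae N0) => h Hh /(_ Logic.I)[] /eqP; rewrite sqrf_eq0 => /eqP h0.
  by rewrite rkhs_normE// -rnE// h0 abse0 lee_fin.
pose c := Num.sqrt I.
have Igt0 : 0 < I by rewrite lt0r In0.
have c0 : 0 < c by rewrite sqrtr_gt0.
have cI : c ^+ 2 = I by rewrite sqr_sqrtr.
have cB : c <= B by rewrite -(ger0_norm B0) -sqrtr_sqr ler_sqrt ?sqr_ge0.
have mg : measurable_fun [set: fun_space H] (fun h => I^-1 * rn h ^+ 2).
  exact: measurable_funM.
have g0 (h : fun_space H) : 0 <= I^-1 * rn h ^+ 2.
  by rewrite mulr_ge0 ?invr_ge0// sqr_ge0.
have [|P PE] := reweighted_probability mg g0 (measurable_normalize (ltW c0)) (mu := mu).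
  under eq_integral do rewrite EFinM.
  rewrite ge0_integralZl//; last 3 first.
  - exact/measurable_EFinP.
  - by move=> h _; rewrite lee_fin sqr_ge0.
  - by rewrite lee_fin invr_ge0.
  by rewrite II -EFinM mulVf.
exists P; split.
- apply: probability_full; first exact: measurable_carrier.
  rewrite PE; last 2 first.
  + apply/measurable_EFinP; apply: measurable_indic; apply: measurableC.
    exact: measurable_carrier.
  + by move=> h; rewrite lee_fin.
  rewrite integral0_eq// => h _; rewrite indicE memNset ?mule0//=.
- apply: sqr_has_kernel_of => // a b x y.
  have msq : measurable_fun [set: fun_space H]
      (fun h : fun_space H => ((a * sigma (h x) + b * sigma (h y)) ^+ 2)%:E).
    exact: measurable_sqr_combination.
  rewrite PE//; last by move=> h; rewrite lee_fin sqr_ge0.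
  have [_ <-] := has_kernel_of_sqr muk a b x y.
  apply: ge0_ae_eq_integral => //.
  + apply: emeasurable_funM; first exact/measurable_EFinP.
    exact: (measurableT_comp msq (measurable_normalize (ltW c0))).
  + by move=> h _; rewrite mule_ge0// lee_fin// sqr_ge0.
  + by move=> h _; rewrite lee_fin sqr_ge0.
  apply: (ae_imply _ ae) => h Hh _; rewrite -EFinM; congr EFin.
  have [h0|hn0] := eqVneq (rn h) 0.
    rewrite h0 expr0n mulr0 mul0r (rnorm_eq0 Hh) -?rnE//.
    by rewrite -[0 x]/(0 : R) -[0 y]/(0 : R) s0 !mulr0 addr0 expr0n.
  rewrite -[normalize c h x]/(c / rn h * h x) -[normalize c h y]/(c / rn h * h y).
  have cr0 : 0 <= c / rn h by rewrite divr_ge0// ltW.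
  rewrite !sigma_homo// -cI; field.
  by rewrite hn0 gt_eqF.
- apply: Lnorm_inftyle_indic; rewrite PE; last 2 first.
  + by apply/measurable_EFinP; apply: measurable_indic; exact: measurable_norm_gt.
  + by move=> h; rewrite lee_fin.
  rewrite integral0_eq// => h _; rewrite indicE memNset ?mule0//.
  apply/negP; rewrite -leNgt gee0_abs ?rkhs_norm_ge0// rkhs_normE//.
  by rewrite lee_fin (le_trans _ cB)// rnorm_normalize// ltW.
Qed.

End normalization.

(** * Ladders *)

Section ladders.
Context {R : realType} {d : nat} {X : set 'rV[R]_d}.
Variables (sigma : R -> R).
Implicit Types (H : rkhs R X) (ch : nat -> rkhs R X) (t : nat -> R) (p : \bar R)
  (f g : X -> R).

(** A chain together with positive real bounds realized by measures; the first space is given by its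
    kernel alone. *)
Definition ladder p L ch t : Prop := kern (ch 1%N) = linear_kern /\
  forall l, (1 <= l < L)%N ->
    0 < t l /\ step_le sigma p (ch l) (ch l.+1) (t l).

Lemma prod_ge0 (L : nat) t : (forall l, (1 <= l < L)%N -> 0 <= t l) ->
  0 <= \prod_(1 <= l < L) t l.
Proof.
move=> t0; rewrite big_seq; apply: prodr_ge0 => i.
by rewrite mem_index_iota; exact: t0.
Qed.

(** Measures realize only bounds strictly above the costs, which are infima. A strict inequality for
    the product leaves room to enlarge every factor; the increase is additive because factors may be
    0. *)
Lemma prod_perturb (L : nat) t (a c : R) : 0 <= a ->
  (forall l, (1 <= l < L)%N -> 0 <= t l) ->
  a * \prod_(1 <= l < L) t l < c ->
  exists u : nat -> R, (forall l, (1 <= l < L)%N -> t l < u l) /\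
    a * \prod_(1 <= l < L) u l < c.
Proof.
elim: L c => [|L IH] c a0 t0.
  by rewrite !big_geq// => h; exists t; split=> [l|]; [rewrite andbF|rewrite big_geq].
case: L IH t0 => [|L] IH t0.
  rewrite !big_geq// => h; exists t; split => [l|]; last by rewrite big_geq.
  by rewrite ltnS leqn0 => /andP[/[swap]/eqP->].
have t0' l : (1 <= l < L.+1)%N -> 0 <= t l.
  by move=> /andP[l1 l2]; apply: t0; rewrite l1 ltnS ltnW.
have P0 := mulr_ge0 a0 (prod_ge0 t0').
have tL0 : 0 <= t L.+1 by apply: t0; rewrite ltnS leqnn.
rewrite big_nat_recr//= mulrA.
set P := a * _ in P0 *; set q := t L.+1 in tL0 * => Pqc.
(* Since [e <= 1], the product [(P + e) * (q + e)] is at most [P * q + e * (P + q + 1)]. *)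
pose e := Num.min 1 ((c - P * q) / (P + q + 2)).
have pos : 0 < P + q + 2 by lra.
have e0 : 0 < e by rewrite lt_min ltr01 divr_gt0// subr_gt0.
have e1 : e <= 1 by rewrite ge_min lexx.
have ec : e * (P + q + 2) <= c - P * q.
  by rewrite -ler_pdivlMr// ge_min lexx orbT.
have [|u [ut uP]] := IH (P + e) a0 t0'; first by rewrite ltrDl.
exists (fun l => if l == L.+1 then q + e else u l); split.
  move=> l /andP[l1]; rewrite ltnS leq_eqVlt; case: eqP => [-> _|_ /= lL].
    by rewrite ltrDl.
  by apply: ut; rewrite l1.
rewrite big_nat_recr//= eqxx mulrA.
rewrite (eq_big_nat _ _ (F2 := u)); last first.
  by move=> l /andP[_ lL]; rewrite ltn_eqF.
apply: (@lt_le_trans _ _ ((P + e) * (q + e))).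
  by rewrite ltr_pM2r// ltr_wpDl.
by nra.
Qed.

Lemma prode_EFin (L : nat) t :
  (\big[*%E/1%E]_(1 <= l < L) (t l)%:E = (\prod_(1 <= l < L) t l)%:E)%E.
Proof.
by elim/big_rec2 : _ => // i y x _ ->.
Qed.

Lemma le_prode (L : nat) (a b : nat -> \bar R) :
  (forall l, (1 <= l < L)%N -> (0 <= a l <= b l)%E) ->
  (0 <= \big[*%E/1%E]_(1 <= l < L) a l <= \big[*%E/1%E]_(1 <= l < L) b l)%E.
Proof.
move=> ab; rewrite big_seq [X in (_ <= _ <= X)%E]big_seq.
apply: (big_rec2 (fun x y => (0 <= x <= y)%E)).
  by rewrite lexx lee01.
move=> i x y; rewrite mem_index_iota => /ab/andP[a0 ai] /andP[x0 xy].
by rewrite mule_ge0//= lee_pmul.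
Qed.

Lemma complexity_ge0 p L f : (0 <= complexity sigma p L f)%E.
Proof.
apply: le_ereal_inf_tmp => _ [H [Hf _] <-]; rewrite mule_ge0 ?rkhs_norm_ge0//.
apply: le_ereal_inf_tmp => _ [ch _ <-].
have c0 l : (1 <= l < L)%N -> (0 <= step_cost sigma p (ch l) (ch l.+1) <=
    step_cost sigma p (ch l) (ch l.+1))%E by rewrite step_cost_ge0 lexx.
by have /andP[] := le_prode c0.
Qed.

Lemma complexity_le p L ch t f : ladder p L ch t -> carrier (ch L) f ->
  (complexity sigma p L f <= (rnorm (ch L) f * \prod_(1 <= l < L) t l)%:E)%E.
Proof.
move=> [ch1 st] Hf.
have lad : is_ladder sigma p L (ch L) ch.
  split => //; first exact/is_linear_rkhs_kern.
  move=> l /st[_ /step_cost_le sl]; apply: le_lt_trans sl _.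
  by rewrite ltry.
have /andP[prod0 prod_le] : (0 <=
    \big[*%E/1%E]_(1 <= l < L) step_cost sigma p (ch l) (ch l.+1) <=
    \big[*%E/1%E]_(1 <= l < L) (t l)%:E)%E.
  apply: le_prode => l /st[_ /step_cost_le ->]; rewrite andbT.
  exact: step_cost_ge0.
rewrite prode_EFin in prod_le.
have lad_le : (ladder_cost sigma p L (ch L) <= (\prod_(1 <= l < L) t l)%:E)%E.
  by apply: le_trans prod_le; apply: ereal_inf_lbound; exists ch.
apply: (@le_trans _ _ (rkhs_norm (ch L) f * ladder_cost sigma p L (ch L))%E).
  apply: ereal_inf_lbound; exists (ch L) => //; split => //.
  by apply: le_lt_trans lad_le _; rewrite ltry.
by rewrite rkhs_normE// EFinM lee_wpmul2l// lee_fin rnorm_ge0.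
Qed.

Lemma complexity_lt p L f (c : R) : (complexity sigma p L f < c%:E)%E ->
  exists ch t, [/\ ladder p L ch t, carrier (ch L) f &
    rnorm (ch L) f * \prod_(1 <= l < L) t l < c].
Proof.
move=> /[dup] /(le_lt_trans (complexity_ge0 p L f)); rewrite lte_fin => c0.
move=> /ereal_inf_lt[_ [H [Hf Hoo] <-]]; rewrite rkhs_normE// => cost.
have [ch [ch1 chL chst] prod_lt] : exists2 ch, is_ladder sigma p L H ch &
    ((rnorm H f)%:E * \big[*%E/1%E]_(1 <= l < L) step_cost sigma p (ch l) (ch l.+1)
     < c%:E)%E.
  (* For a zero norm there is nothing to divide by, and any ladder of finite cost will do. *)
  have [f0|f0] := eqVneq (rnorm H f) 0.
    move: Hoo => /ereal_inf_lt[_ [ch chP _] _]; exists ch => //.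
    by rewrite f0 mul0e lte_fin.
  have fgt0 : 0 < rnorm H f by rewrite lt0r f0 rnorm_ge0.
  have : (ladder_cost sigma p L H < ((rnorm H f)^-1 * c)%:E)%E.
    by rewrite EFinM lte_pdivlMl.
  move=> /ereal_inf_lt[_ [ch chP <-] lt]; exists ch => //.
  by rewrite -lte_pdivlMl// -EFinM.
have cost_fin l : (1 <= l < L)%N ->
    (fine (step_cost sigma p (ch l) (ch l.+1)))%:E = step_cost sigma p (ch l) (ch l.+1).
  by move=> /chst lt; rewrite fineK// ge0_fin_numE// step_cost_ge0.
rewrite (eq_big_nat _ _ (F2 := fun l =>
  (fine (step_cost sigma p (ch l) (ch l.+1)))%:E)) in prod_lt; last first.
  by move=> l /cost_fin.
rewrite prode_EFin -EFinM lte_fin in prod_lt.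
have [||t [tP tlt]] := prod_perturb _ _ prod_lt; first exact: rnorm_ge0.
  by move=> l _; rewrite fine_ge0// step_cost_ge0.
exists ch, t; rewrite chL; split => //; split; first exact/is_linear_rkhs_kern.
move=> l lL; have := tP l lL => h; split.
  by apply: le_lt_trans h; rewrite fine_ge0// step_cost_ge0.
by apply: step_cost_lt; rewrite -cost_fin// lte_fin.
Qed.

(** Reduces the comparison to real [c] strictly above the complexity, for which a ladder exists. The
    slack is divided by [a + 1] because [a] may be 0. *)
Lemma complexity_le_gt p q L f g (a : R) : 0 <= a ->
  (complexity sigma p L f < +oo)%E ->
  (forall c : R, (complexity sigma p L f < c%:E)%E ->
    (complexity sigma q L g <= (a * c)%:E)%E) ->
  (complexity sigma q L g <= a%:E * complexity sigma p L f)%E.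
Proof.
move=> a0 foo h; have f0 := complexity_ge0 p L f.
have ff : (complexity sigma p L f) \is a fin_num by rewrite ge0_fin_numE.
rewrite -(fineK ff) -EFinM; apply/lee_addgt0Pr => e e0.
have a1 : 0 < a + 1 by rewrite ltr_wpDl.
have e1 : 0 < e / (a + 1) by rewrite divr_gt0.
apply: le_trans (h (fine (complexity sigma p L f) + e / (a + 1)) _) _.
  by rewrite EFinD fineK// lteDl// lte_fin.
rewrite -EFinD lee_fin mulrDr lerD2l mulrA ler_pdivrMr//.
by rewrite mulrC ler_wpM2l// ?ltW// ltrDl.
Qed.

Lemma complexity_mono p q L f : (0 < p)%E -> (p <= q)%E ->
  (complexity sigma p L f <= complexity sigma q L f)%E.
Proof.
move=> p0 pq; have [->|] := eqVneq (complexity sigma q L f) +oo%E.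
  by rewrite leey.
rewrite -ltey => foo; rewrite -[leRHS]mul1e.
apply: complexity_le_gt => // c /complexity_lt[ch [t [[ch1 st] Hf lt]]].
rewrite mul1r; apply: le_trans (complexity_le (t := t) _ Hf) _; last first.
  by rewrite lee_fin ltW.
split => // l /st[tl sl]; split => //; exact: step_le_mono sl.
Qed.

End ladders.

(** * Combinations and limits of kernels *)

Section gram_kernels.
Context {R : realType} {T : Type}.
Implicit Types (a b : seq (R * T)) (k : T -> T -> R).

Lemma gram_lin k1 k2 (s t : R) a b :
  gram (fun x y => s * k1 x y + t * k2 x y) a b = s * gram k1 a b + t * gram k2 a b.
Proof.
rewrite /gram -!comboZr -comboD; congr combo; apply/funext => x.
rewrite -[RHS]/(s * combo b (k1 x) + t * combo b (k2 x)).
by rewrite -!comboZr -comboD.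
Qed.

Lemma gramZ k (s : R) a b : gram (fun x y => s * k x y) a b = s * gram k a b.
Proof.
rewrite /gram -comboZr; congr combo; apply/funext => x.
by rewrite -[RHS]/(s * combo b (k x)) -comboZr.
Qed.

Lemma gram_sum (c : nat -> R) (k_ : nat -> T -> T -> R) m a b :
  gram (fun x y => \sum_(0 <= n < m) c n * k_ n x y) a b =
  \sum_(0 <= n < m) c n * gram (k_ n) a b.
Proof.
elim: m => [|m IH].
  transitivity (0 * gram (fun _ _ => 0) a b); last by rewrite mul0r big_geq.
  rewrite -gramZ; congr gram.
  by apply/funext => x; apply/funext => y; rewrite big_geq// mul0r.
rewrite big_nat_recr//= -IH -[X in X + _]mul1r -gram_lin; congr gram.
by apply/funext => x; apply/funext => y; rewrite big_nat_recr//= mul1r.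
Qed.

Lemma combo_cvg (v : nat -> T -> R) (w : T -> R) a :
  (forall x, v ^~ x @ \oo --> w x) -> (fun n => combo a (v n)) @ \oo --> combo a w.
Proof.
move=> vw; elim: a => [|i a IH].
  rewrite /combo big_nil (_ : (fun n => _) = fun=> 0); first exact: cvg_cst.
  by apply/funext => n; rewrite big_nil.
rewrite /combo big_cons (_ : (fun n => _) = (fun n => i.1 * v n i.2 + combo a (v n))).
  by apply: cvgD IH; apply: cvgMr; exact: vw.
by apply/funext => n; rewrite big_cons.
Qed.

Lemma gram_cvg (u : nat -> T -> T -> R) k a b :
  (forall x y, (fun n => u n x y) @ \oo --> k x y) ->
  (fun n => gram (u n) a b) @ \oo --> gram k a b.
Proof. by move=> uk; apply: combo_cvg => x; apply: combo_cvg => y; exact: uk. Qed.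

Lemma cvg_ge (u : nat -> R) (l c : R) : u @ \oo --> l ->
  (\forall n \near \oo, c <= u n) -> c <= l.
Proof.
move=> ul cu; rewrite -(cvg_lim (@Rhausdorff R) ul); apply: limr_ge => //.
by apply/cvg_ex; exists l.
Qed.

Lemma psd_cvg (u : nat -> T -> T -> R) k : (forall n, psd (u n)) ->
  (forall x y, (fun n => u n x y) @ \oo --> k x y) -> psd k.
Proof.
move=> up uk; split=> [x y|a].
  have h := uk y x; rewrite (_ : (fun n => u n y x) = (fun n => u n x y)) in h.
    exact: (cvg_unique _ (uk x y) h).
  by apply/funext => n; exact: (up n).1.
apply: (cvg_ge (gram_cvg (a := a) (b := a) uk)).
by apply: nearW => n; exact: (up n).2.
Qed.

End gram_kernels.

(** * Growth of the kernels along a chain *)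

Section growth.
Context {R : realType} {d : nat} {X : set 'rV[R]_d}.
Variables (sigma : R -> R).
Implicit Types (H : rkhs R X) (ch : nat -> rkhs R X) (t : nat -> R) (p : \bar R)
  (f g : X -> R).

Lemma kern_ge0 H x : 0 <= kern H x x.
Proof. by have := (kern_psd H).2 [:: (1, x)]; rewrite gram1 expr1n mul1r. Qed.

Definition kern_dist H x y := kern H x x - 2 * kern H x y + kern H y y.

Lemma kern_dist_ge0 H x y : 0 <= kern_dist H x y.
Proof.
have := (kern_psd H).2 ([:: (1, x)] ++ [:: (-1, y)]).
rewrite !(gram_catl, gram_catr) !gram1 /gram !combo1 (kern_sym H y x) /kern_dist.
by lra.
Qed.

Variables (p : \bar R) (J : R) (L : nat).
Hypotheses (p2 : (2%:E <= p)%E) (J0 : 0 <= J).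
Hypothesis lip : forall u v : R, `|sigma u - sigma v| <= J * `|u - v|.
Hypothesis s0 : sigma 0 = 0.

Lemma ladder_kern_le ch t x y : ladder sigma p L ch t -> forall l, (1 <= l <= L)%N ->
  kern (ch l) x x <=
    (J ^+ l.-1 * \prod_(1 <= i < l) t i) ^+ 2 * linear_kern x x /\
  kern_dist (ch l) x y <=
    (J ^+ l.-1 * \prod_(1 <= i < l) t i) ^+ 2 * dotv (\val x - \val y) (\val x - \val y).
Proof.
move=> [ch1 st]; elim=> // -[_ _|l IH /andP[_ lL]].
  rewrite big_geq// expr0 mulr1 expr1n !mul1r ch1 /kern_dist ch1; split => //.
  by rewrite dotvB /linear_kern; lra.
have [|tl sl] := st l.+1; first by rewrite lL.
have [|kx kxy] := IH; first by rewrite (ltnW lL).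
set P := J ^+ l * _ in kx kxy.
have -> : J ^+ l.+1 * \prod_(1 <= i < l.+2) t i = J * t l.+1 * P.
  by rewrite big_nat_recr//= exprS /P; ring.
(* [K] stands for the diagonal, with coefficients (1, 0), and for the squared distance, with
   coefficients (1, -1); both grow by the factor [(J * t l.+1) ^+ 2]. *)
have step C (a b : R) (K : rkhs R X -> R) :
    (forall H, K H = a ^+ 2 * kern H x x + 2 * a * b * kern H x y +
      b ^+ 2 * kern H y y) ->
    K (ch l.+1) <= C -> 0 <= K (ch l.+1) ->
    (forall h, carrier (ch l.+1) h ->
      (a * sigma (h x) + b * sigma (h y)) ^+ 2 <=
      J ^+ 2 * K (ch l.+1) * rnorm (ch l.+1) h ^+ 2) ->
    K (ch l.+2) <= (J * t l.+1) ^+ 2 * C.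
  move=> KE KC K0 hK; rewrite KE.
  apply: le_trans (step_growth p2 (ltW tl) _ sl hK) _.
    by rewrite mulr_ge0 ?sqr_ge0.
  by rewrite exprMn mulrAC ler_wpM2l// mulr_ge0 ?sqr_ge0.
have sq_le (u v c n : R) : `|u| <= J * `|v| -> `|v| <= n * Num.sqrt c ->
    0 <= c -> 0 <= n ->
    u ^+ 2 <= J ^+ 2 * c * n ^+ 2.
  move=> uv vc c0 n0; rewrite -[u ^+ 2]real_normK ?num_real//.
  rewrite -{1}[c]sqr_sqrtr// -!exprMn ler_sqr ?nnegrE ?mulr_ge0 ?sqrtr_ge0//.
  by apply: le_trans uv _; rewrite -mulrA ler_wpM2l// mulrC.
split.
- rewrite exprMn -mulrA.
  apply: (step _ 1 0 (fun H => kern H x x)) => //; first by move=> H; ring.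
    exact: kern_ge0.
  move=> h Hh; rewrite mul1r mul0r addr0; apply: (sq_le _ (h x)).
  + by have := lip (h x) 0; rewrite s0 !subr0.
  + exact: rnorm_eval.
  + exact: kern_ge0.
  + exact: rnorm_ge0.
- rewrite exprMn -mulrA.
  apply: (step _ 1 (-1) (fun H => kern_dist H x y)) => //.
  + by move=> H; rewrite /kern_dist; ring.
  + exact: kern_dist_ge0.
  move=> h Hh; rewrite mul1r mulN1r; apply: (sq_le _ (h x - h y)).
  + exact: lip.
  + exact: rnorm_eval2.
  + exact: kern_dist_ge0.
  + exact: rnorm_ge0.
Qed.

Hypothesis L1 : (1 <= L)%N.

(** The passage to the infimum over ladders, shared by the two estimates of (b); [z] is the squared
    length of a point or of a difference of points. *)
Let bound f (a z : R) : (complexity sigma p L f < +oo)%E -> 0 <= z ->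
  (forall ch t, ladder sigma p L ch t -> carrier (ch L) f ->
    a <= rnorm (ch L) f * Num.sqrt ((J ^+ L.-1 * \prod_(1 <= i < L) t i) ^+ 2 * z)) ->
  (a%:E <= (J ^+ L.-1)%:E * complexity sigma p L f * (Num.sqrt z)%:E)%E.
Proof.
move=> foo z0 ha; have f0 := complexity_ge0 sigma p L f.
have ff : (complexity sigma p L f) \is a fin_num by rewrite ge0_fin_numE.
rewrite -(fineK ff) -!EFinM lee_fin; set r := fine _.
have r0 : 0 <= r by exact: fine_ge0.
pose k := J ^+ L.-1 * Num.sqrt z.
have k0 : 0 <= k by rewrite mulr_ge0 ?exprn_ge0 ?sqrtr_ge0.
apply/ler_addgt0Pr => e e0.
have e1 : 0 < e / (k + 1) by rewrite divr_gt0// ltr_wpDl.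
have [|ch [t [lad Hf lt]]] := @complexity_lt _ _ _ sigma p L f (r + e / (k + 1)).
  by rewrite -[ltLHS](fineK ff) lte_fin ltrDl.
have P0 : 0 <= \prod_(1 <= i < L) t i.
  by apply: prod_ge0 => l /lad.2[/ltW].
apply: le_trans (ha ch t lad Hf) _.
rewrite sqrtrM ?sqr_ge0// sqrtr_sqr ger0_norm; last by rewrite mulr_ge0 ?exprn_ge0.
rewrite (_ : rnorm _ _ * _ = rnorm (ch L) f * \prod_(1 <= i < L) t i * k); last first.
  by rewrite /k; ring.
apply: le_trans (ler_wpM2r k0 (ltW lt)) _.
rewrite mulrDl (_ : r * k = J ^+ L.-1 * r * Num.sqrt z); last by rewrite /k; ring.
rewrite lerD2l mulrAC ler_pdivrMr ?ltr_wpDl//.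
by rewrite ler_wpM2l// ?ltW// ltrDl.
Qed.

Lemma complexity_eval f x : ladder_space sigma p L f ->
  (`|f x|%:E <= (J ^+ L.-1)%:E * complexity sigma p L f * (enorm (\val x))%:E)%E.
Proof.
move=> foo; apply: bound => //; first exact: dotv_ge0.
move=> ch t lad Hf; apply: le_trans (rnorm_eval x Hf) _.
rewrite ler_wpM2l ?rnorm_ge0// ler_wsqrtr//.
by have [|] := ladder_kern_le x x lad (l := L); first by rewrite L1 /=.
Qed.

Lemma complexity_lipschitz f x y : ladder_space sigma p L f ->
  (`|f x - f y|%:E <=
   (J ^+ L.-1)%:E * complexity sigma p L f * (enorm (\val x - \val y))%:E)%E.
Proof.
move=> foo; apply: bound => //; first exact: dotv_ge0.
move=> ch t lad Hf; apply: le_trans (rnorm_eval2 x y Hf) _.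
rewrite ler_wpM2l ?rnorm_ge0// ler_wsqrtr//.
by have [|] := ladder_kern_le x y lad (l := L); first by rewrite L1 /=.
Qed.

End growth.

(** * Continuity from the Euclidean Lipschitz bound *)

Section continuity.
Context {R : realType} {d : nat} {X : set 'rV[R]_d}.

(** The topology of ['rV[R]_d] comes from the maximum norm, whence the factor [Num.sqrt d%:R]. *)
Lemma enorm_le (z : 'rV[R]_d) : enorm z <= Num.sqrt d%:R * `|z|.
Proof.
rewrite /enorm -[`|z|]ger0_norm// -sqrtr_sqr -sqrtrM// ler_wsqrtr//.
rewrite mulr_natl -[X in _ *+ X]card_ord -sumr_const; apply: ler_sum => i _.
rewrite -expr2 -[z 0 i ^+ 2]real_normK ?num_real// ler_sqr ?nnegrE//.
rewrite [leRHS]mx_normrE.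
by apply: (le_bigmax _ (fun ij => `|z ij.1 ij.2|) (ord0, i)).
Qed.

Lemma enorm_lipschitz_continuous (f : X -> R) (C : R) :
  (forall x y : X, `|f x - f y| <= C * enorm (\val x - \val y)) -> continuous f.
Proof.
move=> fC x; apply: (@cvgrPdist_lt _ R^o X (nbhs x) _ f (f x)).2 => e e0.
have C0 : 0 < `|C| * Num.sqrt d%:R + 1 by rewrite ltr_wpDl// mulr_ge0// sqrtr_ge0.
have := @initial_continuous X 'rV[R]_d set_val x.
move=> /(@cvgrPdist_lt _ _ X (nbhs x) _ set_val)/(_ (e / (`|C| * Num.sqrt d%:R + 1))).
rewrite divr_gt0// => /(_ isT); apply: filterS => y.
rewrite ltr_pdivlMr// => xy; apply: le_lt_trans (fC x y) _; apply: le_lt_trans xy.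
apply: (@le_trans _ _ (`|C| * (Num.sqrt d%:R * `|\val x - \val y|))).
  apply: (@le_trans _ _ (`|C| * enorm (\val x - \val y))).
    by rewrite ler_wpM2r ?sqrtr_ge0// ler_norm.
  by rewrite ler_wpM2l// enorm_le.
rewrite mulrA mulrC ler_wpM2l// lerDl//.
Qed.

End continuity.

(** * The vector space structure *)

Section subspace.
Context {R : realType} {d : nat} {X : set 'rV[R]_d}.
Variables (sigma : R -> R).
Implicit Types (H : rkhs R X) (ch : nat -> rkhs R X) (t : nat -> R) (p : \bar R)
  (f g : X -> R).
Hypothesis ms : measurable_fun [set: R] sigma.

Lemma step_le_weaken p H H' (B C : R) : B <= C ->
  step_le sigma p H H' B -> step_le sigma p H H' C.
Proof.
move=> BC [mu [mu1 muk muB]]; exists mu; split => //.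
by apply: le_trans muB _; rewrite lee_fin.
Qed.

(** From level 2 on the kernel is constantly [sigma 0 * sigma 0], which the Dirac mass at 0 produces
    from any space. The bound 0 is weakened to 1 because a ladder has positive bounds. *)
Lemma ladder_exists p L : (0 < p)%E -> exists ch, ladder sigma p L ch (fun=> 1).
Proof.
move=> p0; pose k0 (x y : X) := sigma 0 * sigma 0.
have kp : psd k0.
  split=> // a; rewrite /gram.
  rewrite (_ : (fun _ => _) = combo a (fun=> sigma 0) *: (fun=> sigma 0)).
    by rewrite comboZr -expr2 sqr_ge0.
  apply/funext => x; rewrite -[RHS]/(combo a (fun=> sigma 0) * sigma 0).
  rewrite mulrC -comboZr; congr combo.
have [H0 kH0] := moore_aronszajn kp.
have [H1 kH1] := moore_aronszajn (@linear_kern_psd R d X).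
exists (fun l => if l == 1%N then H1 else H0); split => // l /andP[l1 _].
split => //; rewrite [l.+1 == _]eqSS (gtn_eqF l1).
apply: (@step_le_weaken _ _ _ 0); first exact: ler01.
by apply: dirac_step => // x y; rewrite kH0.
Qed.

(** The mean of two terms written as a mixture over all [n]: index 0 has weight 1/2, and the other
    indices together have 1/2. *)
Let pair_cvg (u v : R) :
  series (fun n => half n * 1 ^+ 2 * (if n == 0%N then u else v)) @ \oo --> (u + v) / 2.
Proof.
rewrite (_ : series _ = (fun n => series (@half R) n * v +
    (if n == 0%N then 0 else half 0 * (u - v)))); last first.
  apply/funext => -[|n]; first by rewrite /series/= !big_geq// mul0r addr0.
  rewrite /series/= !big_nat_recl//= expr1n !mulr1 mulrDl.
  rewrite (eq_bigr (fun i => half i.+1 * v)); last by move=> i _; rewrite mulr1.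
  by rewrite mulr_suml; ring.
rewrite (_ : (u + v) / 2 = 1 * v + half 0 * (u - v)); last first.
  by rewrite /half expr1; field.
apply: cvgD; first by apply: cvgMl; exact: cvg_half.
apply/cvgrPdist_lt => e e0; exists 1%N => // n /= n0.
by rewrite gtn_eqF// subrr normr0.
Qed.

(** Each space embeds into that of the averaged kernel with norm at most [Num.sqrt 2], a factor paid
    at every level; the membership in [ladder_space] is unaffected. The first level is kept, as the
    average of the linear kernel with itself. *)
Lemma ladder_average p L ch1 ch2 t1 t2 : (0 < p)%E ->
  ladder sigma p L ch1 t1 -> ladder sigma p L ch2 t2 ->
  exists ch t, ladder sigma p L ch t /\ forall l,
    carrier (ch1 l) `<=` carrier (ch l) /\ carrier (ch2 l) `<=` carrier (ch l).
Proof.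
move=> p0 [k1 st1] [k2 st2].
pose K l (x y : X) := 2^-1 * kern (ch1 l) x y + 2^-1 * kern (ch2 l) x y.
have Kgram l a : gram (K l) a a =
    2^-1 * gram (kern (ch1 l)) a a + 2^-1 * gram (kern (ch2 l)) a a.
  exact: gram_lin.
have Kp l : psd (K l).
  split=> [x y|a].
    by rewrite /K (kern_sym (ch1 l) x) (kern_sym (ch2 l) x).
  by rewrite Kgram addr_ge0// mulr_ge0// ?invr_ge0//; exact: (kern_psd _).2.
pose ch l := sval (cid (moore_aronszajn (Kp l))).
have chK l : kern (ch l) = K l by exact: (svalP (cid (moore_aronszajn (Kp l)))).
have gram0 H a : 0 <= gram (kern H) a a by exact: (kern_psd H).2.
have s2 : Num.sqrt 2 ^+ 2 = 2 :> R by rewrite sqr_sqrtr.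
have sub1 l f : carrier (ch1 l) f ->
    carrier (ch l) (1 *: f) /\ rnorm (ch l) (1 *: f) <= Num.sqrt 2 * rnorm (ch1 l) f.
  apply: rnormZ_le; first exact: sqrtr_ge0.
  move=> a; rewrite s2 chK Kgram; have := gram0 (ch2 l) a.
  by rewrite expr1n mul1r; lra.
have sub2 l f : carrier (ch2 l) f ->
    carrier (ch l) (1 *: f) /\ rnorm (ch l) (1 *: f) <= Num.sqrt 2 * rnorm (ch2 l) f.
  apply: rnormZ_le; first exact: sqrtr_ge0.
  move=> a; rewrite s2 chK Kgram; have := gram0 (ch1 l) a.
  by rewrite expr1n mul1r; lra.
exists ch, (fun l => Num.sqrt 2 * Num.max (t1 l) (t2 l)); split; last first.
  move=> l; split => f; first by move=> /sub1[]; rewrite scale1r.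
  by move=> /sub2[]; rewrite scale1r.
split.
  rewrite chK /K k1 k2; apply/funext => x; apply/funext => y.
  by field.
move=> l lL; have [t10 s1] := st1 l lL; have [t20 s2'] := st2 l lL.
have m0 : 0 < Num.max (t1 l) (t2 l) by rewrite lt_max t10.
split; first by rewrite mulr_gt0// sqrtr_gt0.
apply: (@mixture_step _ _ _ _ _ _ (fun n => if n == 0%N then ch1 l else ch2 l)
  (fun n => if n == 0%N then ch1 l.+1 else ch2 l.+1) (fun=> 1)) => //.
- exact: ltW.
- by move=> n u; rewrite !mul1r.
- by move=> n f; case: ifP => _; [exact: sub1|exact: sub2].
- move=> n; case: ifP => _.
    by apply: step_le_weaken s1; rewrite le_max lexx.
  by apply: step_le_weaken s2'; rewrite le_max lexx orbT.
- move=> x y; rewrite chK.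
  rewrite (_ : K _ x y = (kern (ch1 l.+1) x y + kern (ch2 l.+1) x y) / 2).
    rewrite (_ : (fun n => _) = (fun n => half n * 1 ^+ 2 *
      (if n == 0%N then kern (ch1 l.+1) x y else kern (ch2 l.+1) x y))).
      exact: pair_cvg.
    by apply/funext => n; case: ifP.
  by rewrite /K; ring.
Qed.

Lemma ladder_space_ladder p L f : ladder_space sigma p L f ->
  exists ch t, ladder sigma p L ch t /\ carrier (ch L) f.
Proof.
move=> foo; have ff : complexity sigma p L f \is a fin_num.
  by rewrite ge0_fin_numE// complexity_ge0.
have [|ch [t [lad Hf _]]] := @complexity_lt _ _ _ sigma p L f
    (fine (complexity sigma p L f) + 1).
  by rewrite -[ltLHS](fineK ff) lte_fin ltrDl.
by exists ch, t.
Qed.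

Lemma ladder_ladder_space p L ch t f : ladder sigma p L ch t -> carrier (ch L) f ->
  ladder_space sigma p L f.
Proof.
by move=> lad Hf; apply: le_lt_trans (complexity_le lad Hf) _; rewrite ltry.
Qed.

Lemma ladder_space_subspace p L : (0 < p)%E ->
  linear_subspace (@ladder_space R d X sigma p L).
Proof.
move=> p0; split.
  have [ch lad] := ladder_exists L p0.
  exact: ladder_ladder_space lad (carrier0 _).
move=> a f g /ladder_space_ladder[ch1 [t1 [lad1 Hf]]].
move=> /ladder_space_ladder[ch2 [t2 [lad2 Hg]]].
have [ch [t [lad sub]]] := ladder_average p0 lad1 lad2.
apply: (ladder_ladder_space lad); apply: carrierD.
  by apply: carrierZ; exact: (sub L).1.
exact: (sub L).2.
Qed.

End subspace.

(** * Homogeneous activations *)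

Section homogeneous.
Context {R : realType} {d : nat} {X : set 'rV[R]_d}.
Variables (sigma : R -> R).
Implicit Types (H : rkhs R X) (ch : nat -> rkhs R X) (t : nat -> R) (p : \bar R)
  (f g : X -> R).
Hypothesis sigma_homo : forall u a : R, 0 <= a -> sigma (a * u) = a * sigma u.

(** A homogeneous activation is a combination of two ramps; measurability and the Lipschitz bound
    are read off this form. *)
Let homoE u : sigma u = Num.max u 0 * sigma 1 + Num.max (- u) 0 * sigma (-1).
Proof.
have [u0|u0] := leP 0 u.
  rewrite max_r ?oppr_le0// mul0r addr0.
  by rewrite -sigma_homo// mulr1.
rewrite max_l ?oppr_ge0 ?(ltW u0)// mul0r add0r.
by rewrite -sigma_homo ?oppr_ge0 ?(ltW u0)// mulrNN mulr1.
Qed.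

Lemma homogeneous_measurable : measurable_fun [set: R] sigma.
Proof.
rewrite (_ : sigma = fun u => Num.max u 0 * sigma 1 + Num.max (- u) 0 * sigma (-1)).
  apply: measurable_funD; apply: measurable_funM => //.
    by apply: measurable_maxr.
  by apply: measurable_maxr => //; exact: measurable_funN.
by apply/funext => u; exact: homoE.
Qed.

Lemma homogeneous_lipschitz u v :
  `|sigma u - sigma v| <= (`|sigma 1| + `|sigma (-1)|) * `|u - v|.
Proof.
have maxB (a b : R) : `|Num.max a 0 - Num.max b 0| <= `|a - b|.
  have := ler_norm (a - b); have := ler_norm (b - a); rewrite (distrC b a).
  by rewrite ler_norml; case: (leP a 0) => ?; case: (leP b 0) => ? ? ?;
    apply/andP; split; lra.
rewrite (homoE u) (homoE v).
rewrite (_ : _ - _ = (Num.max u 0 - Num.max v 0) * sigma 1 +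
  (Num.max (- u) 0 - Num.max (- v) 0) * sigma (-1)); last by ring.
apply: (le_trans (ler_normD _ _)); rewrite !normrM mulrDl.
apply: lerD; rewrite mulrC ler_wpM2l//.
by apply: le_trans (maxB _ _) _; rewrite -opprD normrN.
Qed.

Lemma homogeneous0 : sigma 0 = 0.
Proof. by have := sigma_homo 0 (lexx 0); rewrite !mul0r. Qed.

Let ms := homogeneous_measurable.

Let lip0 : 0 <= `|sigma 1| + `|sigma (-1)|.
Proof. by rewrite addr_ge0. Qed.

(** The kernel at level [l] is divided by the square of the product [P l] of the bounds below it. As
    [P 1 = 1], the linear level is kept, and the total cost is transferred to the norm of the last
    space. *)
Lemma unit_of_ladder p L ch t : (0 < p)%E -> (1 <= L)%N -> ladder sigma p L ch t ->
  exists ch', ladder sigma p L ch' (fun=> 1) /\ forall f, carrier (ch L) f ->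
    carrier (ch' L) f /\
    rnorm (ch' L) f <= rnorm (ch L) f * \prod_(1 <= l < L) t l.
Proof.
move=> p0 L1 [k1 st]; pose P l := \prod_(1 <= i < l) t i.
have P0 l : (l <= L)%N -> 0 < P l.
  move=> lL; rewrite /P big_seq; apply: prodr_gt0 => i.
  rewrite mem_index_iota => /andP[i1 il]; apply: (st i _).1.
  by rewrite i1 (leq_trans il).
pose K l (x y : X) := (P l)^-1 ^+ 2 * kern (ch l) x y.
have Kgram l a : gram (K l) a a = (P l)^-1 ^+ 2 * gram (kern (ch l)) a a.
  exact: gramZ.
have Kp l : psd (K l).
  split=> [x y|a]; first by rewrite /K kern_sym.
  by rewrite Kgram mulr_ge0 ?sqr_ge0//; exact: (kern_psd _).2.
pose ch' l := sval (cid (moore_aronszajn (Kp l))).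
have chK l : kern (ch' l) = K l by exact: (svalP (cid (moore_aronszajn (Kp l)))).
exists ch'; split; last first.
  move=> f Hf; rewrite mulrC.
  rewrite -[f in carrier (ch' L) f]scale1r -[f in rnorm (ch' L) f]scale1r.
  apply: rnormZ_le Hf; first by rewrite ltW// P0.
  by move=> a; rewrite chK Kgram mulrA -exprMn divff ?expr1n// gt_eqF// P0.
split.
  rewrite chK /K k1 /P big_geq// invr1 expr1n.
  by apply/funext => x; apply/funext => y; rewrite mul1r.
move=> l lL; have [t0 stl] := st l lL; split => //.
have /andP[l1 ltL] := lL.
have PS : P l.+1 = P l * t l by rewrite /P big_nat_recr.
(* For constant sequences the mixture is a single dilation. Its factor, the inverse of [P l.+1], and
   the new norm, [P l] times the old one, combine to [(t l)^-1]. *)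
rewrite -(mulVf (lt0r_neq0 t0)).
apply: (@mixture_step _ _ _ _ _ _ (fun=> ch l) (fun=> ch l.+1)
  (fun=> (P l.+1)^-1)) => //.
- by rewrite invr_ge0 ltW.
- exact: ltW.
- by move=> _ u; rewrite sigma_homo// invr_ge0 ltW// P0.
- move=> _ f; apply: rnormZ_le; first by rewrite invr_ge0 ltW.
  by move=> a; rewrite chK Kgram PS mulrA -exprMn -invfM (mulrC (t l)).
- move=> x y; rewrite chK /K (_ : series _ =
    (fun n => series (@half R) n * ((P l.+1)^-1 ^+ 2 * kern (ch l.+1) x y))).
    by rewrite -[X in _ --> X]mul1r; apply: cvgMl; exact: cvg_half.
  apply/funext => n; rewrite /series/= mulr_suml; apply: eq_bigr => i _.
  exact/esym/mulrA.
Qed.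

Lemma kern_norm_le H x y : `|kern H x y| <= (kern H x x + kern H y y) / 2.
Proof.
have := kern_dist_ge0 H x y; rewrite /kern_dist.
have := (kern_psd H).2 ([:: (1, x)] ++ [:: (1, y)]).
rewrite !(gram_catl, gram_catr) !gram1 /gram !combo1 (kern_sym H y x) => ? ?.
by rewrite ler_norml; apply/andP; split; lra.
Qed.

Section unit_mixture.
Variables (p : \bar R) (L : nat) (ch_ : nat -> nat -> rkhs R X).
Hypotheses (p2 : (2%:E <= p)%E) (L2 : (2 <= L)%N).
Hypothesis lad : forall n, ladder sigma p L (ch_ n) (fun=> 1).

Let c l n : R := half n ^+ l.-1.

Let c_gt0 l n : 0 < c l n.
Proof. by rewrite exprn_gt0// half_gt0. Qed.

(** The growth estimate bounds the kernels of unit ladders independently of [n], a homogeneous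
    activation being Lipschitz; from level 2 on the weights are at most [half n], hence summable. *)
Let mixture_cvg l x y : (2 <= l <= L)%N ->
  cvgn (series (fun n => c l n * kern (ch_ n l) x y)).
Proof.
move=> /andP[l2 lL]; apply: normed_cvg.
pose J := `|sigma 1| + `|sigma (-1)|.
pose b := (J ^+ l.-1) ^+ 2 * ((linear_kern x x + linear_kern y y) / 2).
have kb n : `|kern (ch_ n l) x y| <= b.
  apply: le_trans (kern_norm_le _ _ _) _.
  have lL' : (1 <= l <= L)%N by rewrite lL (ltnW l2).
  have growth z :=
    (ladder_kern_le p2 lip0 homogeneous_lipschitz homogeneous0 z z (lad n) lL').1.
  have kx := growth x; have ky := growth y.
  by rewrite big1 ?mulr1 -/J // in kx ky; rewrite /b; lra.
have b0 : 0 <= b by apply: le_trans (kb 0%N); exact: normr_ge0.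
apply: (@series_le_cvg _ _ (fun n => half n * b)).
- by move=> n; exact: normr_ge0.
- by move=> n; rewrite mulr_ge0// ltW// half_gt0.
- move=> n; rewrite /= normrM (gtr0_norm (c_gt0 l n)).
  apply: ler_pM => //; first exact: ltW.
  rewrite /c (_ : l.-1 = l.-2.+1); last by move: l2; case: (l) => [|[|]].
  rewrite exprS ger_pMr ?half_gt0//.
  apply: exprn_ile1; first by rewrite ltW// half_gt0.
  by apply: exprn_ile1; rewrite ?invr_ge0// invf_le1// ler1n.
- rewrite (_ : series _ = (fun n => series (@half R) n * b)).
    by apply/cvg_ex; exists (1 * b); apply: cvgMl; exact: cvg_half.
  by apply/funext => n; rewrite /series/= mulr_suml.
Qed.

(** At level 1 all weights are 1 and the series would not converge in general; the linear kernel,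
    common to all chains, is kept instead. *)
Let K l (x y : X) := if (2 <= l <= L)%N then
  limn (series (fun n => c l n * kern (ch_ n l) x y)) else linear_kern x y.

Let K_cvg l x y : (2 <= l <= L)%N ->
  series (fun n => c l n * kern (ch_ n l) x y) @ \oo --> K l x y.
Proof. by move=> lL; rewrite /K lL; exact: mixture_cvg. Qed.

Let K_psd l : psd (K l).
Proof.
have [lL|/negbTE lL] := boolP (2 <= l <= L)%N; last first.
  by rewrite (_ : K l = linear_kern) ?/K ?lL//; exact: linear_kern_psd.
apply: (@psd_cvg _ _ (fun m x y => \sum_(0 <= n < m) c l n * kern (ch_ n l) x y)).
  move=> m; split=> [x y|a]; first by apply: eq_bigr => n _; rewrite kern_sym.
  rewrite gram_sum; apply: sumr_ge0 => n _.
  by rewrite mulr_ge0 ?(ltW (c_gt0 _ _))//; exact: (kern_psd _).2.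
by move=> x y; exact: K_cvg.
Qed.

Let ch l := sval (cid (moore_aronszajn (K_psd l))).

Let chK l : kern (ch l) = K l.
Proof. exact: (svalP (cid (moore_aronszajn (K_psd l)))). Qed.

Let gram_ch_ge l n a : (1 <= l <= L)%N ->
  c l n * gram (kern (ch_ n l)) a a <= gram (kern (ch l)) a a.
Proof.
case: l => [//|[_|l lL]].
  by rewrite chK (_ : K 1 = linear_kern) // (lad n).1 /c expr0 mul1r.
have K_lim x y := @K_cvg l.+2 x y lL.
rewrite chK; apply: (cvg_ge (gram_cvg (a := a) (b := a) K_lim)).
exists n.+1 => // m /= nm; rewrite gram_sum.
rewrite (big_cat_nat _ (n := n.+1))//= big_nat_recr//= addrAC lerDr addr_ge0//.
  apply: sumr_ge0 => i _; rewrite mulr_ge0 ?(ltW (c_gt0 _ _))//.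
  exact: (kern_psd _).2.
apply: sumr_ge0 => i _; rewrite mulr_ge0 ?(ltW (c_gt0 _ _))//.
exact: (kern_psd _).2.
Qed.

(* The spaces at level l are weighted by half n ^ (l - 1) and the measures by
   half n, after a dilation that makes the embedding of level l contractive. *)
Lemma unit_mixture : exists ch, ladder sigma p L ch (fun=> 1) /\
  forall n f, carrier (ch_ n L) f -> carrier (ch L) f /\
    rnorm (ch L) f <= (Num.sqrt (half n) ^+ L.-1)^-1 * rnorm (ch_ n L) f.
Proof.
have sq n l : (Num.sqrt (half n) ^+ l) ^+ 2 = half n ^+ l :> R.
  by rewrite exprAC sqr_sqrtr// ltW// half_gt0.
exists ch; split; last first.
  move=> n f; rewrite -{2 3}[f]scale1r; apply: rnormZ_le.
    by rewrite invr_ge0 exprn_ge0 ?sqrtr_ge0.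
  move=> a; rewrite exprVn sq expr1n mul1r mulrC ler_pdivlMr ?(c_gt0 L n)//.
  by rewrite mulrC gram_ch_ge// (ltnW L2) /=.
split; first by rewrite chK.
move=> l /andP[l1 lL]; split => //; rewrite -[X in step_le _ _ _ _ X]mulr1.
have p0 : (0 < p)%E by apply: lt_le_trans p2; rewrite lte_fin.
apply: (@mixture_step _ _ _ _ _ _ (ch_ ^~ l) (ch_ ^~ l.+1)
  (fun n => Num.sqrt (half n) ^+ l.-1)) => //.
- by move=> n u; rewrite sigma_homo// exprn_ge0// sqrtr_ge0.
- move=> n f; apply: rnormZ_le => // a; rewrite sq expr1n mul1r.
  by apply: gram_ch_ge; rewrite l1 ltnW.
- by move=> n; have [|_] := (lad n).2 l; first by rewrite l1.
- move=> x y; rewrite chK.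
  rewrite (_ : (fun n => _) = (fun n => c l.+1 n * kern (ch_ n l.+1) x y)).
    by apply: K_cvg; rewrite !ltnS l1.
  by apply/funext => n; rewrite sq /c -exprS prednK.
Qed.

End unit_mixture.

End homogeneous.

(** * The quasi-norm and its completeness *)

Section quasi_banach.
Context {R : realType} {d : nat} {X : set 'rV[R]_d}.
Variables (sigma : R -> R) (L : nat).
Implicit Types (H : rkhs R X) (ch : nat -> rkhs R X) (p q : \bar R) (f g : X -> R).
Hypothesis sigma_homo : forall u a : R, 0 <= a -> sigma (a * u) = a * sigma u.
Hypothesis L2 : (2 <= L)%N.

Let L1 : (1 <= L)%N. Proof. exact: ltnW. Qed.

Let p_gt0 p : (2%:E <= p)%E -> (0 < p)%E.
Proof. by apply: lt_le_trans; rewrite lte_fin. Qed.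

Let ms := homogeneous_measurable sigma_homo.

(** By monotonicity every exponent is squeezed between 2 and [+oo], and normalizing the measures of
    each step closes the gap. *)
Lemma homogeneous_complexity_eq p q f : (2%:E <= p)%E -> (2%:E <= q)%E ->
  complexity sigma p L f = complexity sigma q L f.
Proof.
have infty : (complexity sigma +oo L f <= complexity sigma 2%:E L f)%E.
  have [->|] := eqVneq (complexity sigma 2%:E L f) +oo%E; first by rewrite leey.
  rewrite -ltey => foo; rewrite -[leRHS]mul1e.
  apply: complexity_le_gt => // c /complexity_lt[ch [t [[ch1 st] Hf lt]]].
  rewrite mul1r; apply: le_trans (complexity_le (t := t) _ Hf) _.
    split => // l /st[t0 sl]; split => //.
    exact: (step_normalize sigma_homo ms (ltW t0) sl).
  by rewrite lee_fin ltW.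
suff E r : (2%:E <= r)%E -> complexity sigma r L f = complexity sigma +oo L f.
  by move=> p2 q2; rewrite !E.
move=> r2; apply/eqP; rewrite eq_le complexity_mono ?leey ?p_gt0//=.
apply: le_trans infty _; apply: complexity_mono => //.
Qed.

Variable p : \bar R.
Hypothesis p2 : (2%:E <= p)%E.

Local Notation S := (@ladder_space R d X sigma p L).
Local Notation N := (@complexity R d X sigma p L).
Local Notation unit_ladder ch := (ladder sigma p L ch (fun=> 1)).

Let p0 : (0 < p)%E := p_gt0 p2.

(** With all costs normalized, the complexity becomes the infimum of the norms of [f] in the last
    spaces of unit ladders. *)
Lemma complexity_lt_unit f (c : R) : (N f < c%:E)%E ->
  exists ch, [/\ unit_ladder ch, carrier (ch L) f & rnorm (ch L) f < c].
Proof.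
move=> /complexity_lt[ch [t [lad Hf lt]]].
have [ch' [lad' sub]] := unit_of_ladder sigma_homo p0 L1 lad.
have [Hf' le] := sub f Hf; exists ch'; split => //.
exact: le_lt_trans le lt.
Qed.

Lemma complexity_le_unit ch f : unit_ladder ch -> carrier (ch L) f ->
  (N f <= (rnorm (ch L) f)%:E)%E.
Proof.
by move=> lad Hf; have := complexity_le lad Hf; rewrite big1 ?mulr1.
Qed.

Let S_fin f : S f -> N f \is a fin_num.
Proof. by move=> Sf; rewrite ge0_fin_numE// complexity_ge0. Qed.

Let S_sub : linear_subspace S.
Proof. exact: ladder_space_subspace. Qed.

Let complexityZ_le (a : R) f : S f -> (N (a *: f) <= `|a|%:E * N f)%E.
Proof.
move=> Sf; apply: complexity_le_gt => // c /complexity_lt_unit[ch [lad Hf lt]].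
apply: le_trans (complexity_le_unit lad (carrierZ a Hf)) _.
by rewrite lee_fin rnormZ// ler_wpM2l// ltW.
Qed.

Lemma homogeneous_complexityZ (a : R) f : S f -> N (a *: f) = (`|a|%:E * N f)%E.
Proof.
move=> Sf; apply/eqP; rewrite eq_le complexityZ_le//=.
have [->|a0] := eqVneq a 0; first by rewrite normr0 mul0e complexity_ge0.
have := complexityZ_le a^-1 (subspaceZ S_sub a Sf).
rewrite scalerA mulVf// scale1r normfV.
by rewrite -lee_pdivlMl ?normr_gt0.
Qed.

(** By the pointwise bound of (b), a function of zero complexity vanishes everywhere. *)
Lemma complexity_gt0 f : S f -> f <> 0 -> (0 < N f)%E.
Proof.
move=> Sf f0; rewrite lt_neqAle complexity_ge0 andbT; apply/eqP => Nf0.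
apply: f0; apply/funext => x; apply/eqP; rewrite -normr_le0.
have := complexity_eval p2 (addr_ge0 (normr_ge0 _) (normr_ge0 _))
  (homogeneous_lipschitz sigma_homo) (homogeneous0 sigma_homo) L1 x Sf.
by rewrite -Nf0 mule0 mul0e lee_fin.
Qed.

Let sqrt_half_gt0 n : 0 < Num.sqrt (half n) ^+ L.-1 :> R.
Proof. by rewrite exprn_gt0// sqrtr_gt0 half_gt0. Qed.

Let sqrt_half1 : Num.sqrt (half 1) = 2^-1 :> R.
Proof. by rewrite /half sqrtr_sqr ger0_norm ?invr_ge0. Qed.

(** The ladder of [f] takes index 0 of a mixture and that of [g] all the others. The embeddings of
    indices 0 and 1 have norms at most [2^((L-1)/2)] and [2^(L-1)], as [half 1] is 1/4; the larger
    is the constant. *)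
Lemma complexity_triangle f g : S f -> S g ->
  (N (f + g)%R <= (2 ^+ L.-1)%:E * (N f + N g))%E.
Proof.
move=> Sf Sg.
have key (a b : R) : (N f < a%:E)%E -> (N g < b%:E)%E ->
    (N (f + g)%R <= (2 ^+ L.-1 * (a + b))%:E)%E.
  move=> /complexity_lt_unit[ch1 [lad1 Hf fa]] /complexity_lt_unit[ch2 [lad2 Hg gb]].
  have [|ch [lad sub]] := unit_mixture sigma_homo p2 L2
      (ch_ := fun n => if n == 0%N then ch1 else ch2).
    by move=> n; case: ifP.
  have [Hf' f'] := sub 0%N f Hf; have [Hg' g'] := sub 1%N g Hg.
  apply: le_trans (complexity_le_unit lad (carrierD Hf' Hg')) _.
  rewrite lee_fin; apply: le_trans (rnormD_le Hf' Hg') _; rewrite mulrDr.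
  apply: lerD.
    apply: le_trans f' _; apply: ler_pM; rewrite ?invr_ge0 ?rnorm_ge0 ?(ltW fa)//.
    rewrite -exprVn; apply: lerXn2r; rewrite ?nnegrE ?invr_ge0 ?sqrtr_ge0//.
    rewrite -[leRHS]invrK lef_pV2 ?posrE ?invr_gt0 ?sqrtr_gt0 ?half_gt0//.
    by rewrite -sqrt_half1 ler_wsqrtr// /half expr1 ger_pMr// invf_le1// ler1n.
  apply: le_trans g' _; apply: ler_pM; rewrite ?invr_ge0 ?rnorm_ge0 ?(ltW gb)//.
  by rewrite sqrt_half1 exprVn invrK.
have K0 : 0 < 2 ^+ L.-1 :> R by rewrite exprn_gt0.
rewrite -(fineK (S_fin Sf)) -(fineK (S_fin Sg)) -EFinD -EFinM.
apply/lee_addgt0Pr => e e0; rewrite -EFinD.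
pose e' := e / (2 ^+ L.-1) / 2.
have e'0 : 0 < e' by rewrite !divr_gt0.
apply: le_trans (key (fine (N f) + e') (fine (N g) + e') _ _) _.
- by rewrite -[ltLHS](fineK (S_fin Sf)) lte_fin ltrDl.
- by rewrite -[ltLHS](fineK (S_fin Sg)) lte_fin ltrDl.
rewrite lee_fin le_eqVlt; apply/orP; left; apply/eqP.
by rewrite /e'; field; rewrite gt_eqF.
Qed.

Lemma complexity_quasi_norm : quasi_norm_on S N.
Proof.
split.
- by move=> f Sf; rewrite complexity_ge0.
- exact: complexity_gt0.
- exact: homogeneous_complexityZ.
- exists (2 ^+ L.-1); first by rewrite exprn_ege1// ler1n.
  exact: complexity_triangle.
Qed.

(* If every u k.+1 - u k is small enough, one unit ladder carries them all, with
   summable norms in its last space. *)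
Let complete_fast (u : nat -> X -> R) : (forall n, S (u n)) ->
  (forall k, (N (u k.+1 - u k)%R < (Num.sqrt (half k) ^+ L.-1 * half k)%:E)%E) ->
  exists2 f, S f & forall e : R, 0 < e -> exists n0 : nat, forall n : nat,
    (n0 <= n)%N -> (N (u n - f)%R < e%:E)%E.
Proof.
move=> Su ufast.
have /choice[ch_ chP] : forall k, exists ch, [/\ unit_ladder ch,
    carrier (ch L) (u k.+1 - u k) &
    rnorm (ch L) (u k.+1 - u k) < Num.sqrt (half k) ^+ L.-1 * half k].
  by move=> k; exact: complexity_lt_unit.
have [|ch [lad sub]] := unit_mixture sigma_homo p2 L2 (ch_ := ch_).
  by move=> k; have [] := chP k.
(* The factor [Num.sqrt (half k) ^+ L.-1] in the assumed speed cancels the norm of the [k]-th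
   embedding. *)
have step k : carrier (ch L) (u k.+1 - u k) /\ rnorm (ch L) (u k.+1 - u k) <= half k.
  have [_ Hk lt] := chP k; have [Hk' le] := sub k _ Hk; split => //.
  apply: le_trans le _; rewrite mulrC ler_pdivrMr// mulrC.
  exact: ltW.
have tail j n : carrier (ch L) (u (n + j)%N - u n) /\
    rnorm (ch L) (u (n + j)%N - u n) <= 2^-1 ^+ n - 2^-1 ^+ (n + j).
  elim: j => [|j [Hj le]].
    by rewrite addn0 !subrr rnorm0; split => //; exact: carrier0.
  have [Hs ls] := step (n + j)%N.
  have -> : u (n + j.+1)%N - u n = (u (n + j).+1 - u (n + j)%N) + (u (n + j)%N - u n).
    by rewrite addnS addrA subrK.
  split; first exact: carrierD.
  apply: le_trans (rnormD_le Hs Hj) _; apply: le_trans (lerD ls le) _.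
  by rewrite addnS /half exprS; lra.
have tail' n m : (n <= m)%N -> carrier (ch L) (u m - u n) /\
    rnorm (ch L) (u m - u n) <= 2^-1 ^+ n.
  move=> nm; rewrite -(subnKC nm); have [Hj le] := tail (m - n)%N n; split => //.
  by apply: le_trans le _; rewrite lerBlDr lerDl exprn_ge0// invr_ge0.
have small e : 0 < e -> exists n0, forall n, (n0 <= n)%N -> 2^-1 ^+ n < e :> R.
  move=> e0; have := @cvg_expr R 2^-1; rewrite ger0_norm ?invr_ge0//.
  rewrite invf_lt1// ltr1n => /(_ isT)/cvgrPdist_lt/(_ e e0)[n0 _ n0P].
  exists n0 => n /n0P; rewrite /= sub0r normrN; apply: le_lt_trans.
  exact: ler_norm.
(* Only differences are known to lie in the last space of the merged ladder, so [u 0] is subtracted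
   before the limit and added back to it. *)
have Hu n : carrier (ch L) (u n - u 0%N) by have [] := tail' 0%N n (leq0n _).
have [|G HG Gu] := carrier_complete Hu.
  move=> e /small[n0 n0P]; exists n0 => m n n0m n0n.
  rewrite opprB addrA subrK lte_fin -/(rnorm _ _).
  have [nm|mn] := leqP n m.
    by apply: le_lt_trans (tail' _ _ nm).2 _; exact: n0P.
  have [Hmn le] := tail' _ _ (ltnW mn).
  rewrite -opprB -scaleN1r rnormZ// normrN1 mul1r.
  by apply: le_lt_trans le _; exact: n0P.
exists (u 0%N + G).
  apply: (subspaceD S_sub); first exact: Su.
  exact: ladder_ladder_space lad HG.
move=> e /Gu[n0 n0P]; exists n0 => n /n0P; apply: le_lt_trans.
have -> : u n - (u 0%N + G) = u n - u 0%N - G by rewrite opprD addrA.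
by apply: complexity_le_unit => //; exact: carrierB.
Qed.

(** A subsequence is fast enough for [complete_fast], and the quasi-triangle inequality brings its
    limit back to the whole sequence. *)
Lemma complexity_complete : complete_for S N.
Proof.
move=> u Su uC.
have SB f g : S f -> S g -> S (f - g).
  by move=> Sf Sg; apply: (subspaceD S_sub) => //; exact: (subspaceN S_sub).
pose w k : R := Num.sqrt (half k) ^+ L.-1 * half k.
have w0 k : 0 < w k by rewrite mulr_gt0// half_gt0.
have /choice[n_ nP] := fun k => uC (w k) (w0 k).
pose m := fix m k : nat := if k is k'.+1 then maxn (m k').+1 (n_ k'.+1) else n_ 0%N.
have m_ge k : (n_ k <= m k)%N by case: k => [|k] //=; exact: leq_maxr.
have mS k : (m k < m k.+1)%N by rewrite /=; exact: leq_maxl.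
have m_id k : (k <= m k)%N by elim: k => // k IH; exact: leq_ltn_trans (mS k).
have [||f Sf fP] := @complete_fast (fun k => u (m k)).
- by move=> k; exact: Su.
- by move=> k; apply: nP; rewrite ?m_ge// (leq_trans (m_ge k))// ltnW.
exists f => // e e0.
have K0 : 0 < 2 ^+ L.-1 :> R by rewrite exprn_gt0.
(* The division by [2 ^+ L.-1] offsets the constant of the quasi-norm. *)
have e'0 : 0 < e / 2 ^+ L.-1 / 2 by rewrite !divr_gt0.
have [k0 k0P] := fP _ e'0; have [n0 n0P] := uC _ e'0.
exists n0 => n n0n; pose k := maxn k0 n0.
have -> : u n - f = (u n - u (m k)) + (u (m k) - f) by rewrite addrA subrK.
apply: le_lt_trans (complexity_triangle _ _) _; [exact: SB..|].
have h1 : (N (u n - u (m k))%R < (e / 2 ^+ L.-1 / 2)%:E)%E.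
  by apply: n0P => //; apply: leq_trans (leq_maxr k0 n0) (m_id _).
have h2 : (N (u (m k) - f)%R < (e / 2 ^+ L.-1 / 2)%:E)%E.
  by apply: k0P; exact: leq_maxl.
rewrite muleC -lte_pdivlMr//.
by rewrite -EFinM [X in X%:E]splitr EFinD lteD.
Qed.

End quasi_banach.

Theorem theorem3 (R : realType) (d : nat) (X : set 'rV[R]_d) (sigma : R -> R)
    (L : nat) (Xcompact : compact X) (L2 : (2 <= L)%N) :
  (* (a) *)
  ((measurable_fun [set: R] sigma -> forall p : \bar R, (0 < p)%E ->
      linear_subspace (@ladder_space R d X sigma p L)) /\
   (forall (p' p : \bar R) (f : X -> R), (0 < p')%E -> (p' <= p)%E ->
      (complexity sigma p' L f <= complexity sigma p L f)%E)) /\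
  (* (b) *)
  (forall (p : \bar R) (J : R), (2%:E <= p)%E ->
     (forall u v : R, `|sigma u - sigma v| <= J * `|u - v|) -> sigma 0 = 0 ->
     (forall f : X -> R, ladder_space sigma p L f ->
        (forall x : X, (`|f x|%R%:E <=
           (J ^+ L.-1)%:E * complexity sigma p L f * (enorm (\val x))%:E)%E) /\
        (forall x y : X, (`|f x - f y|%R%:E <=
           (J ^+ L.-1)%:E * complexity sigma p L f *
             (enorm (\val x - \val y)%R)%:E)%E)) /\
     @ladder_space R d X sigma p L `<=` [set f | continuous f]) /\
  (* (c) *)
  ((forall u a : R, 0 <= a -> sigma (a * u) = a * sigma u) ->
     (forall (p q : \bar R) (f : X -> R), (2%:E <= p)%E -> (2%:E <= q)%E ->
        complexity sigma p L f = complexity sigma q L f) /\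
     (forall p : \bar R, (2%:E <= p)%E ->
        quasi_banach (@ladder_space R d X sigma p L)
          (@complexity R d X sigma p L))).
Proof.
have L1 : (1 <= L)%N by exact: ltnW.
split; first split.
- by move=> ms p p0; exact: ladder_space_subspace.
- by move=> p' p f p'0 p'p; exact: complexity_mono.
split=> [p J p2 lip s0|sigma_homo].
  have J0 : 0 <= J.
    by have := le_trans (normr_ge0 _) (lip 1 0); rewrite subr0 normr1 mulr1.
  split=> [f Sf|f Sf].
    by split=> [x|x y]; [exact: complexity_eval|exact: complexity_lipschitz].
  have ff : complexity sigma p L f \is a fin_num.
    by rewrite ge0_fin_numE// complexity_ge0.
  apply: (@enorm_lipschitz_continuous _ _ _ _ (J ^+ L.-1 * fine (complexity sigma p L f))).
  move=> x y; rewrite -lee_fin 2!EFinM fineK//.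
  exact: complexity_lipschitz.
split=> [p q f|p p2]; first exact: homogeneous_complexity_eq.
split.
- apply: ladder_space_subspace; first exact: homogeneous_measurable.
  by apply: lt_le_trans p2; rewrite lte_fin.
- exact: complexity_quasi_norm.
- exact: complexity_complete.
Qed.
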